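(* Let $u_{\mathcal O,\delta t}$ be the approximate solution of problem $(P)$ defined by the implicit finite volume scheme described in the context. There exists a constant $C_1$ depending on $\Omega$, $T$, $|\phi|_{H_{\mathcal O}}$ such that $$\int_0^T\!\!\int_{\Omega_\eta}\big|\phi(u_{\mathcal O,\delta t}(t,x+\eta))-\phi(u_{\mathcal O,\delta t}(t,x))\big|^2dxdt\le C_1|\eta|\qquad\text{for all }\eta\in\mathbb R^\ell,$$ where $\Omega_\eta=\{x\in\Omega:\ [x+\eta,x]\subset\Omega\}$; and there exists $C_2$ depending on $\Omega$, $T$, $\phi$, $f$ such that $$\int_0^{T-\tau}\!\!\int_\Omega\big|\phi(u_{\mathcal O,\delta t}(t+\tau,x))-\phi(u_{\mathcal O,\delta t}(t,x))\big|^2dxdt\le C_2\,\tau\qquad\text{for all }\tau\in(0,T).$$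
   Context: Data. Let $\ell\ge1$, $\Omega\subset\mathbb R^\ell$ a bounded open set with Lipschitz boundary, $T>0$, $Q=(0,T)\times\Omega$, $u_{\max}>0$. The $\mathbb R^\ell$-valued function $f$ is continuous with $f(0)=f(u_{\max})=0$. The function $\phi$ is nondecreasing and Lipschitz continuous in $[0,u_{\max}]$, and for some $u_c\in[0,u_{\max}]$, $\phi\equiv0$ on $[0,u_c]$ and $\phi$ is strictly increasing on $[u_c,u_{\max}]$. The couple $(f,\phi)$ is non-degenerate: for every $\xi\in\mathbb R^\ell\setminus\{0\}$ the function $\lambda\mapsto\sum_i\xi_if_i(\lambda)$ is not affine on the non-degenerate subintervals of $[0,u_c]$. The initial datum $u_0$ takes values in $[0,u_{\max}]$. Problem $(P)$: $u_t+\operatorname{div}f(u)-\Delta\phi(u)=0$ in $Q$, $u(0,\cdot)=u_0$ in $\Omega$, and $(f(u)-\nabla\phi(u))\cdot n=0$ on $(0,T)\times\partial\Omega$, $n$ being the outward unit normal to $\partial\Omega$. (In the claim $\eta$ is a translation vector.) Mesh. $\mathcal O$ is a family of disjoint connected polygonal control volumes $K\subset\Omega$ whose closures have union $\overline\Omega$, the common interface of two control volumes being included in a hyperplane; $h=\sup_K\operatorname{diam}K$. There is $\alpha>0$ with $\alpha h^\ell\le m(K)$ and $m(\partial K)\le\frac1\alpha h^{\ell-1}$ for all $K$, which gives $|\mathcal O|\le\frac{m(\Omega)}{\alpha}h^{-\ell}$ for the number $|\mathcal O|$ of control volumes; $m$ denotes $\ell$- or $(\ell-1)$-dimensional measure.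 $\mathcal N(K)$ is the set of neighbours of $K$; $K|L$ is the common edge of $K$ and $L\in\mathcal N(K)$; $\bar\varepsilon_K$ is the set of all edges of $K$ (including those on $\partial\Omega$); $n_{K,\sigma}$ is the unit normal to $\sigma$ outward to $K$. The mesh is admissible: there are points $x_K\in K$ such that the line $x_Kx_L$ is orthogonal to $K|L$; $d_{K,L}=|x_K-x_L|$, $\tau_{K|L}=m(K|L)/d_{K,L}$. Seminorm. For a discrete function $w_{\mathcal O}=(w_K)_{K\in\mathcal O}$, $|w_{\mathcal O}|_{H_{\mathcal O}}^2=\ell\sum_{K\in\mathcal O}\sum_{L\in\mathcal N(K)}\frac{m(K|L)}{d_{K,L}}(w_L-w_K)^2$; $|\phi|_{H_{\mathcal O}}$ denotes this discrete $H^1_0$ seminorm of $\phi(u_{\mathcal O,\delta t})$. Numerical fluxes. For $K\in\mathcal O$, $\sigma\in\bar\varepsilon_K$, the flux $F_{K,\sigma}:\mathbb R^2\to\mathbb R$ (written $F_{K,L}$ if $\sigma=K|L$) satisfies, for arguments in $[0,u_{\max}]$: (monotone) $F_{K,\sigma}(a,b)$ is nondecreasing in $a$ and nonincreasing in $b$; (conservative) $F_{K,L}(a,b)=-F_{L,K}(b,a)$; (regular) $F_{K,\sigma}$ is Lipschitz continuous with Lipschitz constant $m(\sigma)M$; (consistent) $F_{K,\sigma}(s,s)=m(\sigma)f(s)\cdot n_{K,\sigma}$. Scheme. With time step $\delta t>0$: $u_K^0=\frac1{m(K)}\int_Ku_0\,dx$, and for all $n\ge0$, $K\in\mathcal O$,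 $$m(K)\frac{u_K^{n+1}-u_K^n}{\delta t}+\sum_{L\in\mathcal N(K)}F_{K,L}(u_K^{n+1},u_L^{n+1})-\sum_{L\in\mathcal N(K)}\tau_{K|L}\big(\phi(u_L^{n+1})-\phi(u_K^{n+1})\big)=0$$ (fluxes through boundary edges are zero). If the scheme has a solution, the function $u_{\mathcal O,\delta t}(t,x)=u_K^{n+1}$ for $x\in K$, $t\in(n\delta t,(n+1)\delta t]$ is called an approximate solution of $(P)$. *)

(* Defs.v *)
From HB Require Import structures.
From mathcomp Require Import all_boot all_order all_algebra.
From mathcomp Require Import all_classical all_reals all_analysis.

Set Implicit Arguments.
Unset Strict Implicit.
Unset Printing Implicit Defensive.

Import Order.TTheory GRing.Theory Num.Theory.
Import numFieldNormedType.Exports.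

Local Open Scope classical_set_scope.
Local Open Scope ring_scope.

(* The library norm of ['rV[R]_l] is the sup norm, hence [enorm]. *)
Definition dot (R : realType) (l : nat) (x y : 'rV[R]_l) : R :=
  \sum_(i < l) x ord0 i * y ord0 i.

Definition enorm (R : realType) (l : nat) (x : 'rV[R]_l) : R :=
  Num.sqrt (dot x x).

Definition diam (R : realType) (l : nat) (A : set 'rV[R]_l) : R :=
  sup [set r | exists x y, [/\ A x, A y & r = enorm (x - y)]].

Definition bd (T : topologicalType) (A : set T) : set T :=
  closure A `\` interior A.

Section lebesgue_step.
Context {R : realType} (n : nat).
Let RT := measurableTypeR R.
Variable m : {sigma_finite_measure set (n.-tuple RT) -> \bar R}.

Definition tcons (p : RT * n.-tuple RT) : n.+1.-tuple RT := [tuple of p.1 :: p.2].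
Definition tuncons (t : n.+1.-tuple RT) : RT * n.-tuple RT :=
  (thead t, [tuple of behead t]).

Lemma measurable_tcons : measurable_fun setT tcons.
Proof. exact: measurable_cons. Qed.

Lemma measurable_tuncons : measurable_fun setT tuncons.
Proof.
apply/measurable_fun_pairP; split => /=.
  exact: measurable_tnth.
exact: measurable_behead.
Qed.

Definition leb_step : set (n.+1.-tuple RT) -> \bar R :=
  fun A => (@lebesgue_measure R \x m)%E (tcons @^-1` A).

Let s0 : leb_step set0 = 0%E.
Proof. by rewrite /leb_step preimage_set0 measure0. Qed.

Let s_ge0 A : (0 <= leb_step A)%E.
Proof. exact: measure_ge0. Qed.

Let s_add : semi_sigma_additive leb_step.
Proof.
have mp A : measurable A -> measurable (tcons @^-1` A).
  by move=> mA; rewrite -[X in measurable X]setTI; exact: measurable_tcons.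
move=> F mF tF mUF; rewrite /leb_step preimage_bigcup.
apply: measure_semi_sigma_additive.
- by move=> k; exact: mp.
- apply/trivIsetP => i j _ _ ij.
  move/trivIsetP : tF => /(_ i j I I ij) tF.
  by rewrite -preimage_setI tF preimage_set0.
- by rewrite -preimage_bigcup; exact: mp.
Qed.

HB.instance Definition _ := isMeasure.Build _ _ _ leb_step s0 s_ge0 s_add.

Let s_sigma_finite : sigma_finite setT leb_step.
Proof.
have /sigma_finiteP[F [TF ndF Foo]] := sigma_finiteT (@lebesgue_measure R).
have /sigma_finiteP[G [TG ndG Goo]] := sigma_finiteT m.
have tK A : tcons @^-1` (tuncons @^-1` A) = A.
  by apply/seteqP; split=> -[x t] /=;
    rewrite /tuncons /tcons/= theadE (_ : [tuple of _] = t)//; exact/val_inj.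
exists (fun k => tuncons @^-1` (F k `*` G k)).
  apply/esym/seteqP; split=> // t _.
  have [i _ Fi] : (\bigcup_k F k) (tuncons t).1 by rewrite -TF.
  have [j _ Gj] : (\bigcup_k G k) (tuncons t).2 by rewrite -TG.
  exists (maxn i j) => //; split.
    by move: Fi; exact/subsetPset/ndF/leq_maxl.
  by move: Gj; exact/subsetPset/ndG/leq_maxr.
move=> k; have [mF Fk] := Foo k; have [mG Gk] := Goo k; split.
  rewrite -[X in measurable X]setTI; apply: measurable_tuncons => //.
  exact: measurableX.
by rewrite /leb_step tK product_measure1E// lte_mul_pinfty// ge0_fin_numE.
Qed.

HB.instance Definition _ :=
  Measure_isSigmaFinite.Build _ _ _ leb_step s_sigma_finite.

End lebesgue_step.

(* The Borel sigma-algebra of the library lives on tuples, the topology and the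
   linear structure on row vectors: [vec] passes from the former to the latter. *)
Fixpoint leb (R : realType) (n : nat) :
    {sigma_finite_measure set (n.-tuple (measurableTypeR R)) -> \bar R} :=
  match n with
  | 0 => \d_([tuple] : 0.-tuple (measurableTypeR R))
  | k.+1 => leb_step (leb R k)
  end.

Definition vec (R : realType) (l : nat) (t : l.-tuple (measurableTypeR R)) :
  'rV[R]_l := \row_i tnth t i.

Definition xint (R : realType) (l : nat) (A : set 'rV[R]_l)
    (g : 'rV[R]_l -> \bar R) : \bar R :=
  (\int[leb R l]_(t in @vec R l @^-1` A) g (vec t))%E.

Definition vmeas (R : realType) (l : nat) (A : set 'rV[R]_l) : R :=
  fine (leb R l (@vec R l @^-1` A)).

Definition normal_to (R : realType) (l : nat) (S : set 'rV[R]_l) :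
    set 'rV[R]_l :=
  [set n | dot n n = 1 /\ exists c, forall y, S y -> dot y n = c].

Definition flat (R : realType) (l : nat) (S : set 'rV[R]_l) : Prop :=
  normal_to S !=set0.

Definition prism (R : realType) (l : nat) (S : set 'rV[R]_l) (n : 'rV[R]_l) :
    set 'rV[R]_l :=
  [set z | exists y t, [/\ S y, 0 <= t <= 1 & z = y + t *: n]].

(* For S contained in a hyperplane, the (l-1)-dimensional Lebesgue measure of S
   is the volume of the right prism of height 1 over S.  If S has several unit
   normals n <> -n', its measure is 0 for each of them, so that the choice made
   by [xget] is irrelevant; for l = 1 a point has measure 1.  Used only for
   flat S. *)
Definition smeas (R : realType) (l : nat) (S : set 'rV[R]_l) : R :=
  vmeas (prism S (xget 0 (normal_to S))).

(* Near each of its boundary points, Omega is the strict hypograph, in some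
   direction e, of a Lipschitz function of the component orthogonal to e. *)
Definition lipschitz_boundary (R : realType) (l : nat) (Omega : set 'rV[R]_l) :
    Prop :=
  forall x, bd Omega x ->
    exists (e : 'rV[R]_l) (g : 'rV[R]_l -> R) (k r : R),
      [/\ dot e e = 1, 0 < r,
          forall y z, `|g y - g z| <= k * enorm (y - z) &
          forall y, enorm (y - x) < r ->
            (Omega y <-> dot y e < g (y - dot y e *: e))].

Definition shifted (R : realType) (l : nat) (Omega : set 'rV[R]_l)
    (eta : 'rV[R]_l) : set 'rV[R]_l :=
  [set x | Omega x /\ forall s : R, 0 <= s <= 1 -> Omega (x + s *: eta)].

Record problem_data (R : realType) (l : nat) (umax uc : R)
    (f : R -> 'rV[R]_l) (phi : R -> R) : Prop := ProblemData {
  pd_umax : 0 < umax;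
  pd_uc : 0 <= uc <= umax;
  pd_f_cont : {within `[0, umax], continuous f};
  pd_f0 : f 0 = 0;
  pd_fmax : f umax = 0;
  pd_phi_nondecr : {in `[0, umax] &, {homo phi : a b / a <= b}};
  pd_phi_lip : exists k : R,
    {in `[0, umax] &, forall a b, `|phi a - phi b| <= k * `|a - b|};
  pd_phi0 : {in `[0, uc], forall a, phi a = 0};
  pd_phi_incr : {in `[uc, umax] &, {homo phi : a b / a < b}};
  pd_nondegenerate : forall (xi : 'rV[R]_l) (a b : R),
    xi != 0 -> 0 <= a -> a < b -> b <= uc ->
    ~ exists p q : R, {in `[a, b], forall s, dot xi (f s) = p * s + q}
}.

Definition polygonal (R : realType) (l : nat) (A : set 'rV[R]_l) : Prop :=
  [/\ open A, interior (closure A) = A &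
      exists s : seq ('rV[R]_l * R),
        (forall p, p \in s -> p.1 != 0) /\
        (forall x, bd A x -> exists2 p, p \in s & dot x p.1 = p.2)].

(* [bedge] indexes the edges lying on the boundary of the domain, [bowner b]
   being the control volume to which the edge [bface b] belongs. *)
Record mesh (R : realType) (l : nat) := Mesh {
  cell : finType;
  bedge : finType;
  vol : cell -> set 'rV[R]_l;
  pt : cell -> 'rV[R]_l;
  bface : bedge -> set 'rV[R]_l;
  bowner : bedge -> cell;
  nrm : cell -> cell + bedge -> 'rV[R]_l
}.

Section mesh_notions.
Context {R : realType} {l : nat} (m : mesh R l).

(* As an edge of K, [inl L] stands for K|L. *)
Definition face (K : cell m) (s : cell m + bedge m) : set 'rV[R]_l :=
  match s with
  | inl L => closure (vol K) `&` closure (vol L)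
  | inr b => bface b
  end.

(* L is in N(K): the common interface has positive (l-1)-measure. *)
Definition nb (K L : cell m) : bool := (K != L) && (0 < smeas (face K (inl L))).

Definition is_edge (K : cell m) (s : cell m + bedge m) : bool :=
  match s with
  | inl L => nb K L
  | inr b => bowner b == K
  end.

Definition mesh_size : R := \big[Num.max/0]_(K : cell m) diam (vol K).

Definition dist (K L : cell m) : R := enorm (pt K - pt L).

Definition transm (K L : cell m) : R := smeas (face K (inl L)) / dist K L.

Definition discrete_H (w : cell m -> R) : R :=
  Num.sqrt (l%:R * \sum_(K : cell m) \sum_(L | nb K L)
              smeas (face K (inl L)) / dist K L * (w L - w K) ^+ 2).

(* Interfaces of control volumes are Lebesgue-null; the value there is 0. *)
Definition piecewise (w : cell m -> R) (x : 'rV[R]_l) : R :=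
  \sum_(K : cell m | x \in vol K) w K.

End mesh_notions.

(* In [am_outward], a point of the edge s lying on no other edge of K is a
   relative interior point of s, next to which K lies on exactly one side. *)
Record admissible_mesh (R : realType) (l : nat) (Omega : set 'rV[R]_l)
    (alpha : R) (m : mesh R l) : Prop := AdmissibleMesh {
  am_polygonal : forall K : cell m, polygonal (vol K);
  am_connected : forall K : cell m, connected (vol K);
  am_sub : forall K : cell m, vol K `<=` Omega;
  am_disjoint : forall K L : cell m, K != L -> vol K `&` vol L = set0;
  am_cover : \bigcup_(K : cell m) closure (vol K) = closure Omega;
  am_interface : forall K L : cell m, K != L -> flat (face K (inl L));
  am_bface : forall b : bedge m,
    [/\ closed (bface b), flat (bface b), 0 < smeas (bface b) &
        bface b `<=` bd Omega];
  am_bd : forall K : cell m,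
    bd (vol K) = \bigcup_(s in [set s | is_edge K s]) face K s;
  am_overlap : forall (K : cell m) (s s' : cell m + bedge m),
    is_edge K s -> is_edge K s' -> s != s' ->
    smeas (face K s `&` face K s') = 0;
  am_normal : forall (K : cell m) (s : cell m + bedge m),
    is_edge K s -> normal_to (face K s) (nrm K s);
  am_outward : forall (K : cell m) (s : cell m + bedge m) (y : 'rV[R]_l),
    is_edge K s -> face K s y ->
    (forall s', is_edge K s' -> face K s' y -> s' = s) ->
    exists2 r : R, 0 < r & forall t, 0 < t < r ->
      vol K (y - t *: nrm K s) /\ ~ vol K (y + t *: nrm K s);
  am_pt : forall K : cell m, vol K (pt K);
  am_orthogonal : forall K L : cell m, nb K L ->
    forall y z, face K (inl L) y -> face K (inl L) z ->
      dot (pt L - pt K) (y - z) = 0;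
  am_vol : forall K : cell m, alpha * mesh_size m ^+ l <= vmeas (vol K);
  am_perimeter : forall K : cell m,
    \sum_(s : cell m + bedge m | is_edge K s) smeas (face K s)
      <= alpha^-1 * mesh_size m ^+ l.-1
}.

Record numerical_flux (R : realType) (l : nat) (m : mesh R l) (umax M : R)
    (f : R -> 'rV[R]_l) (F : cell m -> cell m + bedge m -> R -> R -> R) :
    Prop := NumericalFlux {
  nf_monotone_l : forall K s, is_edge K s ->
    {in `[0, umax], forall b, {in `[0, umax] &,
      {homo (F K s)^~ b : a a' / a <= a'}}};
  nf_monotone_r : forall K s, is_edge K s ->
    {in `[0, umax], forall a, {in `[0, umax] &,
      {homo F K s a : b b' / b <= b' >-> b' <= b}}};
  nf_conservative : forall K L, nb K L ->
    {in `[0, umax] &, forall a b, F K (inl L) a b = - F L (inl K) b a};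
  nf_regular : forall K s, is_edge K s ->
    forall a b a' b', a \in `[0, umax] -> b \in `[0, umax] ->
      a' \in `[0, umax] -> b' \in `[0, umax] ->
      `|F K s a b - F K s a' b'|
        <= smeas (face K s) * M * (`|a - a'| + `|b - b'|);
  nf_consistent : forall K s, is_edge K s ->
    {in `[0, umax], forall a,
      F K s a a = smeas (face K s) * dot (f a) (nrm K s)}
}.

(* phi and the fluxes are only given on [0, umax], hence [ss_range]. *)
Record scheme_solution (R : realType) (l : nat) (m : mesh R l) (umax dt : R)
    (phi : R -> R) (F : cell m -> cell m + bedge m -> R -> R -> R)
    (u0 : 'rV[R]_l -> R) (u : nat -> cell m -> R) : Prop := SchemeSolution {
  ss_range : forall n K, 0 <= u n K <= umax;
  ss_init : forall K,
    u 0%N K = (vmeas (vol K))^-1 * fine (xint (vol K) (fun x => (u0 x)%:E));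
  ss_step : forall n K,
    vmeas (vol K) * ((u n.+1 K - u n K) / dt)
    + \sum_(L | nb K L) F K (inl L) (u n.+1 K) (u n.+1 L)
    - \sum_(L | nb K L) transm K L * (phi (u n.+1 L) - phi (u n.+1 K)) = 0
}.

(* the k with t \in ](k - 1) dt, k dt], for t > 0 *)
Definition time_index (R : realType) (dt t : R) : nat :=
  `|Num.ceil (t / dt)|%N.

Definition approx_solution (R : realType) (l : nat) (m : mesh R l) (dt : R)
    (u : nat -> cell m -> R) (t : R) (x : 'rV[R]_l) : R :=
  piecewise (u (time_index dt t)) x.

(* L^2(0,T) norm of the seminorm [discrete_H] of phi(u(t, .)) *)
Definition phi_seminorm (R : realType) (l : nat) (m : mesh R l) (T dt : R)
    (phi : R -> R) (u : nat -> cell m -> R) : R :=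
  Num.sqrt (\int[@lebesgue_measure R]_(t in `[0, T])
    discrete_H (fun K => phi (u (time_index dt t) K)) ^+ 2).

Definition initial_datum (R : realType) (l : nat) (Omega : set 'rV[R]_l)
    (umax : R) (u0 : 'rV[R]_l -> R) : Prop :=
  measurable_fun (@vec R l @^-1` Omega) (u0 \o @vec R l) /\
  forall x, Omega x -> 0 <= u0 x <= umax.

(* Main.v *)
From HB Require Import structures.
Require Import Defs.
From mathcomp Require Import all_boot all_order all_algebra.
From mathcomp Require Import all_classical all_reals all_analysis.
From mathcomp Require Import measurable_realfun ring lra.

(** Write w for the discrete function phi(u(t, .)) at a fixed time, h for the
    mesh size, |.| for the sup norm, and C for constants that depend only on
    Omega, alpha and the dimension l.

    Space translates.  For almost every x the segment [x, x + eta] avoids all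
    interfaces of zero surface measure.  As the segment is connected, the
    control volumes that it touches are then linked to one another through
    interfaces of positive measure that it meets ([crossing_connect]).  Along a
    simple chain of such volumes, Cauchy-Schwarz bounds the square of
    w(x + eta) - w(x) by the number of touched volumes times the sum of
    (w_L - w_K)^2 over the crossed interfaces.  Each volume has measure at
    least alpha h^l, so at most C / h of them fit around the segment
    ([card_touched]); since d_{K,L} <= C h, the factor 1 / h is exchanged for
    the weight 1 / d_{K,L} of the discrete seminorm ([piecewise_shift_le]).
    The points x whose segment crosses K|L form an oblique prism over K|L, of
    measure at most C |eta| m(K|L) ([vmeas_sweep]).  Integrating in x, then
    in t, gives C |eta| times the square of the discrete L^2(H^1) norm.

    The measure of an oblique prism is compared with that of the right prism
    that defines m(K|L) by cutting both into thin slabs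
    ([vmeas_sweep_thicken]); the comparison rests on the translation invariance
    of the measure and on its continuity along decreasing sequences.

    Time translates.  Testing the scheme with phi(u^{n+1}) and bounding the
    convective flux by Young's inequality yields an energy estimate
    ([energy_sum]): the diffusion term controls the seminorm of phi(u), the
    remaining flux terms add up to a multiple of the sum of m(K|L) d_{K,L},
    which the regularity of the mesh bounds ([diamond_sum_le]).  Since phi is
    nondecreasing and Lipschitz, (phi(a) - phi(b))^2 is at most
    C (a - b) (phi(a) - phi(b)); writing u(t + tau) - u(t) as the sum of the
    increments over the time levels in [t, t + tau) and testing the scheme
    with phi(u(t + tau)) - phi(u(t)) bounds the integrand by energies at the
    times involved ([jump_le]).  When t varies, a given time level lies in
    [t, t + tau) for a set of t of measure tau, and the same bound holds for
    the total overlap with a given time step ([overlap_le], [clamp_sum]);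
    this averaging produces the factor tau ([time_shift_le]). *)

Import Order.TTheory GRing.Theory Num.Theory.
Import numFieldNormedType.Exports.

Local Open Scope classical_set_scope.
Local Open Scope ring_scope.

Set Implicit Arguments.
Unset Strict Implicit.
Unset Printing Implicit Defensive.

(** * Integrals bounded by step functions *)

(** The integral of a nonnegative function is a supremum over the simple
    functions below it, so it is monotone for arbitrary [f] and [D]; the null
    set [N] is absorbed by adding to [g] the function that is infinite on it. *)
Lemma le_integral_negl (d : measure_display) (T : measurableType d)
    (R : realType) (mu : {measure set T -> \bar R}) (D N : set T)
    (f g : T -> \bar R) :
  measurable N -> mu N = 0%E -> measurable_fun setT g ->
  (forall x, 0 <= g x)%E -> (forall x, D x -> 0 <= f x)%E ->
  (forall x, D x -> ~ N x -> f x <= g x)%E ->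
  (\int[mu]_(x in D) f x <= \int[mu]_x g x)%E.
Proof.
move=> mN N0 mg g0 f0 fg; set h : T -> \bar R := (cst +oo%E) \_ N.
have h0 x : (0 <= h x)%E by apply: erestrict_ge0 => y _; exact: leey.
have mh : measurable_fun setT h.
  by apply/(measurable_restrictT _ mN); apply: measurable_cst.
have -> : (\int[mu]_x g x = \int[mu]_x (g x + h x))%E.
  rewrite ge0_integralD//; have -> : (\int[mu]_x h x = 0)%E.
    by rewrite -integral_mkcond integral_cst//= N0 mule0.
  by rewrite adde0.
rewrite (ge0_integralE mu f0) ge0_integralTE; last by move=> x; exact: adde_ge0.
apply: ge_ereal_sup => _ [k kf <-]; apply: ereal_sup_ubound; exists k => // x.
apply: le_trans (kf x) _; rewrite patchE; case: ifPn => [|_]; last exact: adde_ge0.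
rewrite inE => Dx; rewrite /h patchE; case: ifPn => Nx.
  by rewrite addey ?leey// gt_eqF// (lt_le_trans _ (g0 x)).
by rewrite adde0; apply: fg => //; rewrite notin_setE in Nx.
Qed.

(** Reduces the estimates of translates to bounds by step functions that
    hold pointwise off a null set. *)
Lemma le_integral_step (d : measure_display) (T : measurableType d)
    (R : realType) (mu : {measure set T -> \bar R}) (D N : set T)
    (f : T -> \bar R) (I : finType) (c : I -> R) (A : I -> set T) :
  measurable N -> mu N = 0%E -> (forall i, 0 <= c i) ->
  (forall i, measurable (A i)) -> (forall x, D x -> 0 <= f x)%E ->
  (forall x, D x -> ~ N x -> (f x <= (\sum_i c i * \1_(A i) x)%:E)%E) ->
  (\int[mu]_(x in D) f x <= \sum_i (c i)%:E * mu (A i))%E.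
Proof.
move=> mN N0 c0 mA f0 fs.
pose g i x : \bar R := ((c i)%:E * (\1_(A i) x)%:E)%E.
have mg i : measurable_fun setT (g i).
  by apply: measurable_funeM; apply/measurable_EFinP; exact: measurable_indic.
have g0 i x : (0 <= g i x)%E by rewrite mule_ge0// lee_fin.
have -> : (\sum_i (c i)%:E * mu (A i) = \int[mu]_x (\sum_i g i x))%E.
  rewrite ge0_integral_sum//; apply: eq_bigr => i _.
  rewrite ge0_integralZl//; first by rewrite integral_indic// setIT.
    by apply/measurable_EFinP; exact: measurable_indic.
  by rewrite lee_fin.
apply: (le_integral_negl mN N0) => //.
- exact: emeasurable_sum.
- by move=> x; exact: sume_ge0.
- by move=> x Dx Nx; rewrite sumEFin; exact: fs.
Qed.

(** The translated measure agrees with the Lebesgue measure on the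
    half-open intervals, which determine it. *)
Lemma lebesgue_measure_translation (R : realType) (a : R)
    (A : set (measurableTypeR R)) : measurable A ->
  lebesgue_measure ((fun x : measurableTypeR R => x + a) @^-1` A)
  = lebesgue_measure A.
Proof.
move=> mA.
have mt : measurable_fun setT
  ((fun x => x + a) : measurableTypeR R -> measurableTypeR R).
  exact: measurable_funD.
pose H := isMeasurableFun.Build _ _ _ _ _ mt.
pose t : {mfun measurableTypeR R >-> measurableTypeR R} := HB.pack
  ((fun x => x + a) : measurableTypeR R -> measurableTypeR R) H.
apply/esym.
apply: (@lebesgue_measure_unique _ (pushforward lebesgue_measure t)) => //.
move=> _ [[b c]] _ <-; rewrite /pushforward /=.
rewrite [X in _ = lebesgue_measure X](_ : _ = `]b - a, c - a]%classic); last first.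
  by apply/seteqP; split=> x; rewrite /= !in_itv/= ltrBlDr lerBrDr.
rewrite !lebesgue_measure_itv/= !lte_fin ltrD2r.
by case: ifP => // _; congr (_%:E); ring.
Qed.

Lemma lebesgue_measure_oc (R : realType) (a b : R) :
  lebesgue_measure (`]a, b]%classic : set (measurableTypeR R)) =
  (Num.max 0 (b - a))%:E.
Proof.
rewrite lebesgue_measure_itv/= lte_fin; case: ltP => ab.
  by rewrite -EFinB max_r// subr_ge0 ltW.
by rewrite max_l// subr_le0.
Qed.

(** * Lebesgue measure on row vectors *)

Definition vleb (R : realType) (l : nat) (A : set 'rV[R]_l) : \bar R :=
  leb R l (@vec R l @^-1` A).

Definition vmeasurable (R : realType) (l : nat) (A : set 'rV[R]_l) : Prop :=
  measurable (@vec R l @^-1` A).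

Definition tshift (R : realType) (l : nat) (a : 'rV[R]_l)
    (t : l.-tuple (measurableTypeR R)) : l.-tuple (measurableTypeR R) :=
  [tuple tnth t i + a ord0 i | i < l].

Lemma vec_tshift (R : realType) (l : nat) (a : 'rV[R]_l) t :
  vec (tshift a t) = vec t + a.
Proof.
by apply/rowP => i; rewrite /vec /tshift !mxE tnth_mktuple.
Qed.

Lemma measurable_tshift (R : realType) (l : nat) (a : 'rV[R]_l) :
  measurable_fun setT (tshift a).
Proof.
apply/measurable_fun_tnthP => i.
rewrite (_ : _ \o _ =
    (fun t : l.-tuple (measurableTypeR R) => (tnth t i : R) + a ord0 i)).
  by apply: measurable_funD => //; exact: measurable_tnth.
by apply/funext => t /=; rewrite tnth_mktuple.
Qed.

(** By induction on the dimension: a product measure is determined by its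
    values on rectangles. *)
Lemma leb_translation (R : realType) (l : nat) (a : 'rV[R]_l)
    (A : set (l.-tuple (measurableTypeR R))) : measurable A ->
  leb R l (tshift a @^-1` A) = leb R l A.
Proof.
elim: l a A => [|l IH] a A mA.
  rewrite (_ : tshift a @^-1` A = A)//.
  by apply/seteqP; split=> t; rewrite /= (tuple0 (tshift a t)) (tuple0 t).
have mcA : measurable (@tcons R l @^-1` A).
  by rewrite -[X in measurable X]setTI; exact: measurable_tcons.
pose b : 'rV[R]_l := \row_i a ord0 (lift ord0 i).
pose s (p : measurableTypeR R * l.-tuple (measurableTypeR R)) :=
  ((p.1 + a ord0 ord0 : measurableTypeR R), tshift b p.2).
have ms : measurable_fun setT s.
  apply/measurable_fun_pairP; split => /=.
    rewrite (_ : _ \o _ =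
      (fun p : measurableTypeR R * l.-tuple (measurableTypeR R) =>
         (p.1 : R) + a ord0 ord0))//.
    by apply: measurable_funD => //; exact: measurable_fst.
  rewrite (_ : _ \o _ = tshift b \o snd)//.
  by apply: measurableT_comp => //; exact: measurable_tshift.
pose H := isMeasurableFun.Build _ _ _ _ _ ms.
pose sf : {mfun _ >-> _} := HB.pack s H.
rewrite /= /leb_step.
have -> : @tcons R l @^-1` (tshift a @^-1` A) = s @^-1` (@tcons R l @^-1` A).
  apply/seteqP; split=> -[x t] /=;
  rewrite (_ : tshift a (tcons (x, t)) = tcons (s (x, t)))//;
  apply/eq_from_tnth => i; rewrite tnth_mktuple /tcons /s/=;
  case: (unliftP ord0 i) => [j ->|->]; rewrite ?tnthS ?tnth0 //=;
  by rewrite tnth_mktuple mxE.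
suff key B C : measurable B -> measurable C ->
    pushforward (lebesgue_measure \x leb R l)%E sf (B `*` C)
    = (lebesgue_measure B * leb R l C)%E.
  exact/esym/(@product_measure_unique _ _ _ _ R lebesgue_measure (leb R l)
    (pushforward (lebesgue_measure \x leb R l)%E sf) key _ mcA).
move=> mB mC.
have mB' : measurable ((fun x : measurableTypeR R => x + a ord0 ord0) @^-1` B).
  rewrite -[X in measurable X]setTI.
  have mt : measurable_fun setT
    ((fun x => x + a ord0 ord0) : measurableTypeR R -> measurableTypeR R).
    exact: measurable_funD.
  exact: mt.
have mC' : measurable (tshift b @^-1` C).
  by rewrite -[X in measurable X]setTI; exact: measurable_tshift.
change ((lebesgue_measure \x leb R l)%E
  (((fun x : measurableTypeR R => x + a ord0 ord0) @^-1` B) `*` (tshift b @^-1` C))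
  = (lebesgue_measure B * leb R l C)%E).
etransitivity; first exact: (product_measure1E lebesgue_measure (leb R l) mB' mC').
by rewrite IH//; congr (_ * _)%E; exact: lebesgue_measure_translation.
Qed.

Lemma vleb_translation (R : realType) (l : nat) (a : 'rV[R]_l)
    (A : set 'rV[R]_l) : vmeasurable A ->
  vleb [set x | A (x + a)] = vleb A.
Proof.
move=> mA; rewrite /vleb -[RHS](leb_translation a)//; congr (leb R l _).
by apply/seteqP; split=> t; rewrite /= vec_tshift.
Qed.

Lemma vmeasurable_translation (R : realType) (l : nat) (a : 'rV[R]_l)
    (A : set 'rV[R]_l) : vmeasurable A -> vmeasurable [set x | A (x + a)].
Proof.
move=> mA; rewrite /vmeasurable.
rewrite (_ : _ @^-1` _ = tshift a @^-1` (@vec R l @^-1` A)).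
  by rewrite -[X in measurable X]setTI; exact: measurable_tshift.
by apply/seteqP; split=> t; rewrite /= vec_tshift.
Qed.

Lemma leb_cube (R : realType) (l : nat) (c : 'I_l -> R) (w : R) : 0 <= w ->
  leb R l [set t | forall i, tnth t i \in `[c i - w, c i + w] ] = ((2 * w) ^+ l)%:E.
Proof.
move=> w0; elim: l c => [|l IH] c.
  rewrite expr0 /=/dirac indicE mem_set// => -[]//.
rewrite /= /leb_step.
rewrite (_ : _ @^-1` _ = `[c ord0 - w, c ord0 + w]%classic `*`
  [set t : l.-tuple _ | forall i,
     tnth t i \in `[c (lift ord0 i) - w, c (lift ord0 i) + w] ]); last first.
  apply/seteqP; split=> -[x t] /=.
    move=> h; split; first by have := h ord0; rewrite tnth0.
    by move=> i; have := h (lift ord0 i); rewrite tnthS.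
  move=> [h1 h2] i.
  by case: (unliftP ord0 i) => [j ->|->]; rewrite ?tnthS ?tnth0 //=.
rewrite product_measure1E//; last first.
  rewrite (_ : mkset _ = \bigcap_(i in [set: 'I_l])
      ((fun t : l.-tuple (measurableTypeR R) => tnth t i) @^-1`
        `[c (lift ord0 i) - w, c (lift ord0 i) + w]%classic)).
    apply: fin_bigcap_measurable => // i _.
    by rewrite -[X in measurable X]setTI; apply: measurable_tnth.
  by apply/seteqP; split=> t /= h i; have := h i => //; exact.
rewrite IH exprS EFinM; congr (_ * _)%E.
etransitivity; first exact: lebesgue_measure_itv.
rewrite /= lte_fin.
case: ltP => h; first by rewrite -EFinB; congr (_%:E); ring.
have -> : w = 0 by lra.
by rewrite mulr0.
Qed.

Lemma coord_le_norm (R : realType) (l : nat) (x : 'rV[R]_l) i :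
  `|x ord0 i| <= `|x|.
Proof.
rewrite [leRHS]/Num.norm /= mx_normrE; apply/bigmax_geP; right => /=.
by exists (ord0, i).
Qed.

Lemma norm_le_coord (R : realType) (l : nat) (x : 'rV[R]_l) c : 0 <= c ->
  (forall i, `|x ord0 i| <= c) -> `|x| <= c.
Proof.
move=> c0 h; rewrite [leLHS]/Num.norm /= mx_normrE; apply/bigmax_leP; split => //=.
by move=> [i j] _ /=; rewrite ord1.
Qed.

Lemma dotDl (R : realType) (l : nat) (x y z : 'rV[R]_l) :
  dot (x + y) z = dot x z + dot y z.
Proof.
by rewrite /dot -big_split/=; apply: eq_bigr => i _; rewrite mxE mulrDl.
Qed.

Lemma dotZl (R : realType) (l : nat) a (x z : 'rV[R]_l) :
  dot (a *: x) z = a * dot x z.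
Proof.
by rewrite /dot mulr_sumr; apply: eq_bigr => i _; rewrite mxE mulrA.
Qed.

Lemma dot_le_norm (R : realType) (l : nat) (x y : 'rV[R]_l) :
  `|dot x y| <= l%:R * (`|x| * `|y|).
Proof.
apply: (le_trans (ler_norm_sum _ _ _)).
apply: (@le_trans _ _ (\sum_(i < l) `|x| * `|y|)).
  by apply: ler_sum => i _; rewrite normrM ler_pM// coord_le_norm.
by rewrite sumr_const card_ord mulr_natl.
Qed.

Lemma dot_ge0 (R : realType) (l : nat) (x : 'rV[R]_l) : 0 <= dot x x.
Proof. by apply: sumr_ge0 => i _; rewrite -expr2 sqr_ge0. Qed.

Lemma norm_le_enorm (R : realType) (l : nat) (x : 'rV[R]_l) : `|x| <= enorm x.
Proof.
apply: norm_le_coord => [|i]; first exact: sqrtr_ge0.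
rewrite -sqrtr_sqr ler_sqrt ?dot_ge0// /dot (bigD1 i)//= -expr2 lerDl.
by apply: sumr_ge0 => j _; rewrite -expr2 sqr_ge0.
Qed.

Lemma enorm_le_norm (R : realType) (l : nat) (x : 'rV[R]_l) :
  enorm x <= l%:R * `|x|.
Proof.
rewrite -[leRHS]ger0_norm ?mulr_ge0// -sqrtr_sqr ler_sqrt ?sqr_ge0//.
apply: le_trans (ler_norm _) _; apply: le_trans (dot_le_norm _ _) _.
rewrite exprMn expr2 -mulrA ler_wpM2l// -expr2.
case: l x => [|l] x; first by rewrite [x]thinmx0 normr0 expr0n mulr0.
by rewrite ler_peMl ?sqr_ge0// ler1n.
Qed.

Lemma open_ballP (R : realType) (l : nat) (U : set 'rV[R]_l) :
  open U <-> forall x, U x -> exists2 e, 0 < e & forall y, `|y - x| < e -> U y.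
Proof.
rewrite openE; split=> h x Ux.
  have /nbhs_ballP[e /= e0 he] := h _ Ux; exists e => // y yx.
  by apply: he; rewrite -ball_normE /ball_/= distrC.
have [e e0 he] := h _ Ux; apply/nbhs_ballP; exists e => //= y.
by rewrite -ball_normE /ball_/= distrC => /he.
Qed.

Definition cube (R : realType) (l : nat) (c : 'rV[R]_l) (w : R) : set 'rV[R]_l :=
  [set x | `|x - c| <= w].

Lemma vec_cubeE (R : realType) (l : nat) (c : 'rV[R]_l) w : 0 <= w ->
  @vec R l @^-1` cube c w =
  [set t | forall i, tnth t i \in `[c ord0 i - w, c ord0 i + w] ].
Proof.
move=> w0; apply/seteqP; split=> t /= h.
  move=> i; have := le_trans (coord_le_norm _ i) h.
  by rewrite !mxE in_itv/= -ler_distlC distrC.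
apply: norm_le_coord => // i; have := h i.
by rewrite !mxE in_itv/= -ler_distlC distrC.
Qed.

Lemma vmeasurable_cube (R : realType) (l : nat) (c : 'rV[R]_l) w : 0 <= w ->
  vmeasurable (cube c w).
Proof.
move=> w0; rewrite /vmeasurable vec_cubeE//.
rewrite (_ : mkset _ = \bigcap_(i in [set: 'I_l])
    ((fun t : l.-tuple (measurableTypeR R) => tnth t i) @^-1`
      `[c ord0 i - w, c ord0 i + w]%classic)).
  apply: fin_bigcap_measurable => // i _.
  by rewrite -[X in measurable X]setTI; apply: measurable_tnth.
by apply/seteqP; split=> t /= h i; have := h i => //; exact.
Qed.

Lemma vleb_cube (R : realType) (l : nat) (c : 'rV[R]_l) w : 0 <= w ->
  vleb (cube c w) = ((2 * w) ^+ l)%:E.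
Proof. by move=> w0; rewrite /vleb vec_cubeE// leb_cube. Qed.

(** An open set is the union of the countably many cubes with rational
    centre and radius 1 / (k + 1) that it contains. *)
Lemma open_vmeasurable (R : realType) (l : nat) (U : set 'rV[R]_l) :
  open U -> vmeasurable U.
Proof.
move/open_ballP => oU.
pose c (q : {ffun 'I_l -> rat}) : 'rV[R]_l := \row_i ratr (q i).
pose F (p : {ffun 'I_l -> rat} * nat) : set 'rV[R]_l :=
  if pselect (cube (c p.1) p.2.+1%:R^-1 `<=` U) then cube (c p.1) p.2.+1%:R^-1
  else set0.
have -> : U = \bigcup_p F p.
  apply/seteqP; split=> [x Ux|x [p _]]; last first.
    by rewrite /F; case: pselect => // h /h.
  have [e e0 he] := oU _ Ux.
  have [k ke] : exists k, (k.+1%:R^-1 : R) < e / 2.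
    have e2 : 0 < e / 2 by rewrite divr_gt0.
    by have [k hk] := ltr_add_invr e2; exists k; rewrite add0r in hk.
  have k0 : 0 < (k.+1%:R^-1 : R) by rewrite invr_gt0.
    set r : R := k.+1%:R^-1 in ke k0.
  have /fin_all_exists[q hq] : forall i, exists q : rat,
      `|x ord0 i - ratr q| <= (k.+1%:R^-1 : R).
    move=> i; have : x ord0 i - k.+1%:R^-1 < x ord0 i by rewrite gtrBl.
    move=> /rat_in_itvoo[q]; rewrite in_itv/= => /andP[q1 q2]; exists q.
    by rewrite -/r in q1 *; rewrite ger0_norm; lra.
  exists (finfun q, k) => //.
  rewrite /F /=; case: pselect => [a /=|[]].
    by apply: norm_le_coord; [exact: ltW|move=> i; rewrite !mxE ffunE].
  move=> y /= hy; apply: he.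
  have -> : y - x = (y - c (finfun q)) + (c (finfun q) - x).
    by rewrite addrA subrK.
  apply: le_lt_trans (ler_normD _ _) _.
  have : `|c (finfun q) - x| <= k.+1%:R^-1.
    by apply: norm_le_coord; [exact: ltW|move=> i; rewrite !mxE ffunE distrC].
  by move: hy; rewrite /cube/= -/r => hy h; lra.
rewrite /vmeasurable preimage_bigcup.
apply: countable_bigcupT_measurable => //.
move=> [q k]; rewrite /F; case: pselect => a /=; last by rewrite preimage_set0.
by apply: vmeasurable_cube; rewrite invr_ge0.
Qed.

Lemma closed_vmeasurable (R : realType) (l : nat) (U : set 'rV[R]_l) :
  closed U -> vmeasurable U.
Proof.
move=> cU; rewrite /vmeasurable -[U]setCK preimage_setC.
by apply: measurableC; have := open_vmeasurable (closed_openC cU).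
Qed.

Lemma le_vleb (R : realType) (l : nat) (A B : set 'rV[R]_l) :
  vmeasurable A -> vmeasurable B -> A `<=` B -> (vleb A <= vleb B)%E.
Proof.
move=> mA mB AB; apply: le_measure; rewrite ?inE//.
by move=> t; exact: AB.
Qed.

Lemma vleb_ge0 (R : realType) (l : nat) (A : set 'rV[R]_l) : (0 <= vleb A)%E.
Proof. exact: measure_ge0. Qed.

Lemma vleb_int (R : realType) (l : nat) (A : set 'rV[R]_l) : vmeasurable A ->
  vleb A = (\int[leb R l]_t (\1_(@vec R l @^-1` A) t)%:E)%E.
Proof. by move=> mA; rewrite integral_indic// setIT. Qed.

Lemma indic_vec (R : realType) (l : nat) (A : set 'rV[R]_l) t :
  \1_(@vec R l @^-1` A) t = \1_A (vec t) :> R.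
Proof. by rewrite !indicE. Qed.

Lemma measurable_indic_vec (R : realType) (l : nat) (A : set 'rV[R]_l) :
  vmeasurable A ->
  measurable_fun setT (fun t => (\1_(@vec R l @^-1` A) t)%:E : \bar R).
Proof.
by move=> mA; apply/measurable_EFinP; apply: measurable_indic; exact: mA.
Qed.

(** Integrate the pointwise comparison of indicator functions. *)
Lemma vleb_sub_sum (R : realType) (l : nat) (I : finType) (A : set 'rV[R]_l)
    (F : I -> set 'rV[R]_l) : vmeasurable A -> (forall i, vmeasurable (F i)) ->
  (forall x, A x -> exists i, F i x) ->
  (vleb A <= \sum_(i : I) vleb (F i))%E.
Proof.
move=> mA mF AF; rewrite vleb_int//.
under eq_bigr => i _ do rewrite vleb_int//.
rewrite -ge0_integral_sum//; first last.
  by move=> i; exact: measurable_indic_vec.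
apply: ge0_le_integral => //.
- exact: measurable_indic_vec.
- by apply: emeasurable_sum => i; exact: measurable_indic_vec.
move=> t _; rewrite sumEFin lee_fin indicE.
have [tA|_] := boolP (t \in _); last by rewrite sumr_ge0.
have [i Fi] := AF _ (set_mem tA); rewrite (bigD1 i)//= indicE mem_set//.
by rewrite lerDl sumr_ge0.
Qed.

Lemma sum_vleb_le (R : realType) (l : nat) (I : finType) (A : set 'rV[R]_l)
    (F : I -> set 'rV[R]_l) : vmeasurable A -> (forall i, vmeasurable (F i)) ->
  (forall i, F i `<=` A) -> (forall i j x, F i x -> F j x -> i = j) ->
  (\sum_(i : I) vleb (F i) <= vleb A)%E.
Proof.
move=> mA mF FA dF; rewrite vleb_int//.
under eq_bigr => i _ do rewrite vleb_int//.
rewrite -ge0_integral_sum//; first last.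
  by move=> i; exact: measurable_indic_vec.
apply: ge0_le_integral => //.
- by move=> x _; rewrite sume_ge0// => i _; rewrite lee_fin.
- by apply: emeasurable_sum => i; exact: measurable_indic_vec.
- exact: measurable_indic_vec.
move=> t _; rewrite sumEFin lee_fin.
have [[i Fi]|nF] := pselect (exists i, F i (vec t)).
  rewrite (bigD1 i)//= big1 ?addr0 => [|j ji].
    by rewrite !indicE !mem_set//; exact: (FA i).
  rewrite indicE memNset//= => Fj.
  by move: ji; rewrite (dF _ _ _ Fj Fi) eqxx.
rewrite big1// => i _; rewrite indicE memNset// => Fi.
by apply: nF; exists i.
Qed.

Lemma vleb_bounded (R : realType) (l : nat) (A : set 'rV[R]_l) c w : 0 <= w ->
  vmeasurable A -> A `<=` cube c w -> (vleb A <= ((2 * w) ^+ l)%:E)%E.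
Proof.
move=> w0 mA Aw; rewrite -(vleb_cube c w0); apply: le_vleb => //.
exact: vmeasurable_cube.
Qed.

Lemma bounded_cubeP (R : realType) (l : nat) (A : set 'rV[R]_l) :
  bounded_set A <-> exists2 w, 0 <= w & A `<=` cube 0 w.
Proof.
split.
  move=> [M [Mr h]]; exists (`|M| + 1); first by rewrite addr_ge0.
  move=> x Ax; rewrite /cube/= subr0; apply: h => //.
  by rewrite ltr_pwDr// ler_norm.
move=> [w w0 h]; exists w; split; first exact: num_real.
by move=> x wx y /h; rewrite /cube/= subr0 => /le_trans; apply; exact: ltW.
Qed.

Lemma vlebE (R : realType) (l : nat) (A : set 'rV[R]_l) : vmeasurable A ->
  bounded_set A -> vleb A = (vmeas A)%:E.
Proof.
move=> mA /bounded_cubeP[w w0 Aw]; rewrite /vmeas -/(vleb A) fineK//.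
rewrite ge0_fin_numE ?vleb_ge0//; apply: le_lt_trans (vleb_bounded w0 mA Aw) _.
by rewrite ltry.
Qed.

(** * Oblique prisms over a flat set *)

(** The starting points [x] of the segments from [x] to [x + eta] that meet
    [S]: an oblique prism over [S]. *)
Definition sweep (R : realType) (l : nat) (S : set 'rV[R]_l) (eta : 'rV[R]_l) :
    set 'rV[R]_l :=
  [set x | exists2 s : R, 0 <= s <= 1 & S (x + s *: eta)].

Lemma compact_sweep (R : realType) (l : nat) (S : set 'rV[R]_l) (eta : 'rV[R]_l) :
  compact S -> compact (sweep S eta).
Proof.
move=> cS.
pose g (p : R * 'rV[R]_l) : 'rV[R]_l := p.2 - p.1 *: eta.
have -> : sweep S eta = g @` (`[0, 1]%classic `*` S).
  apply/seteqP; split=> x /=.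
    move=> [s s01 Sx]; exists (s, x + s *: eta) => /=; first by rewrite in_itv/=.
    by rewrite /g/= addrK.
  move=> [[s y] /= [s01 Sy] <-]; exists s; first by rewrite in_itv/= in s01.
  by rewrite /g/= subrK.
apply: continuous_compact; last first.
  by apply: compact_setX => //; exact: segment_compact.
apply: continuous_subspaceT => p.
apply: cvgB; first exact: cvg_snd.
by apply: cvgZr_tmp; exact: cvg_fst.
Qed.

Lemma compact_vmeasurable (R : realType) (l : nat) (S : set 'rV[R]_l) :
  compact S -> vmeasurable S.
Proof.
move=> cS; apply: closed_vmeasurable.
by apply: compact_closed => //; exact: norm_hausdorff.
Qed.

(** The right prism that defines the surface measure is an instance of
    [sweep], so that compactness is proved once. *)
Lemma prism_sweep (R : realType) (l : nat) (S : set 'rV[R]_l) (n : 'rV[R]_l) :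
  prism S n = sweep S (- n).
Proof.
apply/seteqP; split=> x /=.
  move=> [y [t [Sy t01 ->]]]; exists t => //.
  by rewrite scalerN addrK.
move=> [s s01 Sx]; exists (x + s *: - n), s; split => //.
by rewrite scalerN subrK.
Qed.

Definition thicken (R : realType) (l : nat) (P : set 'rV[R]_l) (e : R) :
    set 'rV[R]_l := [set z | exists2 p, P p & `|z - p| < e].

Lemma open_thicken (R : realType) (l : nat) (P : set 'rV[R]_l) e :
  open (thicken P e).
Proof.
apply/open_ballP => x [p Pp xp]; exists (e - `|x - p|); first by rewrite subr_gt0.
move=> y yx; exists p => //.
rewrite (_ : y - p = (y - x) + (x - p)); last by rewrite addrA subrK.
by apply: le_lt_trans (ler_normD _ _) _; rewrite -ltrBrDr.
Qed.

Lemma bounded_thicken (R : realType) (l : nat) (P : set 'rV[R]_l) (e : R) :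
  bounded_set P -> bounded_set (thicken P e).
Proof.
move=> /bounded_cubeP[w w0 Pw]; apply/bounded_cubeP.
exists (w + `|e|); first by rewrite addr_ge0.
move=> z [p /Pw]; rewrite /cube/= !subr0 => pw zp.
rewrite -[z](subrK p) addrC; apply: le_trans (ler_normD _ _) _.
by apply: lerD => //; apply: le_trans (ltW zp) _; exact: ler_norm.
Qed.

(** The thickenings decrease to the closure of [P], which is [P]. *)
Lemma cvg_vmeas_thicken (R : realType) (l : nat) (P : set 'rV[R]_l) :
  compact P -> (fun k => vmeas (thicken P k.+1%:R^-1)) @ \oo --> vmeas P.
Proof.
move=> cP; pose F k := @vec R l @^-1` thicken P k.+1%:R^-1.
have bP := compact_bounded cP.
have bT e : bounded_set (thicken P e) by exact: bounded_thicken.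
have mT e : vmeasurable (thicken P e).
  by apply: open_vmeasurable; exact: open_thicken.
have FP : \bigcap_k F k = @vec R l @^-1` P.
  apply/seteqP; split=> t /= h; last first.
    by move=> k _; exists (vec t) => //; rewrite subrr normr0 invr_gt0.
  have cl : closed P by apply: compact_closed => //; exact: norm_hausdorff.
  apply: cl => B /nbhs_ballP[e /= e0 he].
  have [k ke] := ltr_add_invr e0; rewrite add0r in ke.
  have [p Pp tp] := h k I; exists p; split => //; apply: he.
  by rewrite -ball_normE /ball_/=; exact: lt_trans tp ke.
have mP := compact_vmeasurable cP.
suff H : (leb R l \o F) @ \oo --> (vmeas P)%:E by exact: (fine_cvg H).
rewrite -vlebE// /vleb -FP; apply: nonincreasing_cvg_mu.
- change (vleb (thicken P 1%:R^-1) < +oo)%E.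
  by rewrite vlebE// ltry.
- by move=> i; exact: mT.
- by rewrite FP; exact: mP.
- move=> i j ij; apply/subsetPset => t [p Pp h]; exists p => //.
  by apply: lt_le_trans h _; rewrite lef_pV2 ?posrE// ler_nat.
Qed.

(** The index [N - 1] serves for [s = 1], so [N] points of the grid
    suffice. *)
Lemma unit_grid (R : realType) (N : nat) (s : R) : (0 < N)%N ->
  0 <= s -> s <= 1 ->
  exists2 i : 'I_N, i%:R <= s * N%:R & s * N%:R <= i%:R + 1.
Proof.
case: N => // N _ s0 s1; have [sl|sl] := leP 1 s.
  exists ord_max; have -> : s = 1 by apply/eqP; rewrite eq_le s1.
    by rewrite mul1r /= ler_nat.
  by rewrite mul1r /= natr1.
have sN : 0 <= s * N.+1%:R by rewrite mulr_ge0.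
have /andP[t1 t2] := truncn_itv sN.
have iN : (Num.trunc (s * N.+1%:R) < N.+1)%N.
  by rewrite -(ltr_nat R); apply: le_lt_trans t1 _; rewrite gtr_pMl.
exists (Ordinal iN) => //=.
by rewrite natr1; exact: ltW t2.
Qed.

(** With M = k + 1, take N just above M l |eta| and let T be the thin
    slab [sweep S (eta / N)].  The oblique prism is covered by N translates of
    T along eta.  In the direction n the thickness of T is less than 1 / M, so
    the M translates of T by (j / M) n, j < M, are disjoint, and they stay
    within distance 1 / M of the right prism over S.  Hence the measure of the
    oblique prism is at most N / M times that of the thickened right prism. *)
Lemma vmeas_sweep_thicken (R : realType) (l : nat) (S : set 'rV[R]_l)
    (n eta : 'rV[R]_l) (c : R) (k : nat) : (0 < l)%N -> compact S ->
  dot n n = 1 -> (forall y, S y -> dot y n = c) ->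
  vmeas (sweep S eta) <=
  (l%:R * `|eta| + k.+1%:R^-1) * vmeas (thicken (prism S n) k.+1%:R^-1).
Proof.
move=> l0 cS nn Sc; set Th := thicken _ _.
have cP : compact (prism S n) by rewrite prism_sweep; exact: compact_sweep.
pose M : nat := k.+1; pose a : R := l%:R * `|eta|.
have a0 : 0 <= a by rewrite mulr_ge0.
pose N : nat := (Num.trunc (M%:R * a)).+1.
have M0 : 0 < M%:R :> R by rewrite ltr0n.
have N0 : 0 < N%:R :> R by rewrite ltr0n.
have aN : M%:R * a < N%:R by exact: truncnS_gt.
have Na : N%:R <= M%:R * a + 1.
  rewrite /N -addn1 natrD lerD2r.
  by have /andP[] := truncn_itv (mulr_ge0 (ltW M0) a0).
have l1 : 1 <= l%:R :> R by rewrite ler1n.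
pose T := sweep S (N%:R^-1 *: eta).
have cT : compact T by exact: compact_sweep.
have mT : vmeasurable T := compact_vmeasurable cT.
have bT := compact_bounded cT.
have mTh : vmeasurable Th by apply: open_vmeasurable; exact: open_thicken.
have bTh : bounded_set Th by apply: bounded_thicken; exact: compact_bounded.
have cE : compact (sweep S eta) by exact: compact_sweep.
have h1 : vmeas (sweep S eta) <= N%:R * vmeas T.
  rewrite -lee_fin -vlebE//; [|exact: compact_vmeasurable|exact: compact_bounded].
  pose F (i : 'I_N) := [set x | T (x + (i%:R / N%:R) *: eta)].
  apply: (@le_trans _ _ (\sum_i vleb (F i))%E).
    apply: vleb_sub_sum; first exact: compact_vmeasurable.
      by move=> i; exact: vmeasurable_translation.
    move=> x [s /andP[s0 s1] Sx].
    have [i ilo ihi] := unit_grid (ltn0Sn _) s0 s1 : exists2 i : 'I_N, _ & _.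
    exists i; exists (s * N%:R - i%:R).
      by rewrite subr_ge0 ilo/= lerBlDl.
    rewrite scalerA -addrA -scalerDl.
    rewrite (_ : _ + _ = s)//.
    by field; rewrite gt_eqF.
  rewrite (eq_bigr (fun=> (vmeas T)%:E)) => [|i _]; last first.
    by rewrite -vlebE// vleb_translation.
  by rewrite sumEFin sumr_const card_ord mulr_natl.
have h2 : M%:R * vmeas T <= vmeas Th.
  rewrite -lee_fin -(vlebE mTh bTh).
  pose F (j : 'I_M) := [set x | T (x + (- (j%:R / M%:R)) *: n)].
  have -> : (M%:R * vmeas T)%:E = (\sum_j vleb (F j))%E.
    rewrite (eq_bigr (fun=> (vmeas T)%:E)) => [|i _]; last first.
    by rewrite -vlebE// vleb_translation.
    by rewrite sumEFin sumr_const card_ord mulr_natl.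
  apply: sum_vleb_le => //.
  - by move=> i; exact: vmeasurable_translation.
  - move=> j x [s /andP[s0 s1]]; set y := (y in S y) => Sy.
    exists (y + (j%:R / M%:R) *: n).
      exists y, (j%:R / M%:R); split => //.
      by rewrite divr_ge0//= ler_pdivrMr// mul1r ler_nat ltnW.
    rewrite /y (_ : x - _ = - ((s / N%:R) *: eta)).
      rewrite normrN normrZ ger0_norm ?divr_ge0// ?ltW//.
      apply: (@le_lt_trans _ _ (N%:R^-1 * a)).
        apply: ler_pM => //; first by rewrite divr_ge0// ltW.
          by rewrite ler_piMl// invr_ge0 ltW.
        by rewrite /a ler_peMl.
      by rewrite -/M mulrC ltr_pdivrMr// mulrC ltr_pdivlMr// mulrC.
    by rewrite scaleNr scalerA addrAC subrK opprD addrA subrr add0r.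
  - move=> i j x [s s01 Sx] [s' s'01 Sx'].
    have := Sc _ Sx; have := Sc _ Sx'.
    rewrite !dotDl !dotZl nn !mulr1 => E1 E2.
    pose d := N%:R^-1 * dot eta n.
    have dM : `|d| < M%:R^-1.
      rewrite normrM ger0_norm ?invr_ge0//.
      have n1 : `|n| <= 1.
        by apply: le_trans (norm_le_enorm _) _; rewrite /enorm nn sqrtr1.
      have : `|dot eta n| <= a.
        apply: le_trans (dot_le_norm _ _) _.
        by rewrite ler_wpM2l// ler_piMr.
      move=> h; apply: (@le_lt_trans _ _ (N%:R^-1 * a)).
        by rewrite ler_wpM2l// invr_ge0 ltW.
      by rewrite mulrC ltr_pdivrMr// mulrC ltr_pdivlMr// mulrC.
    pose q : R := (i%:R - j%:R) / M%:R.
    have E : q = (s - s') * d.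
      rewrite /q /d; have : s * (N%:R^-1 * dot eta n) - i%:R / M%:R =
        s' * (N%:R^-1 * dot eta n) - j%:R / M%:R by lra.
      by lra.
    have : `|q| < M%:R^-1.
      rewrite E normrM; apply: le_lt_trans dM.
      rewrite ler_piMl//.
      by rewrite ler_norml; move/andP: s01 => [? ?]; move/andP: s'01 => [? ?]; lra.
    rewrite /q normrM [X in _ * X]ger0_norm ?invr_ge0//.
    rewrite gtr_pMl ?invr_gt0// ltr_norml => /andP[].
    rewrite ltrBrDl ltrBlDl => u v; apply/val_inj => /=.
    have u' : (j < i.+1)%N by rewrite -(ltr_nat R) -natr1; lra.
    have v' : (i < j.+1)%N by rewrite -(ltr_nat R) -natr1; lra.
    by apply/eqP; rewrite eqn_leq -ltnS v' -ltnS u'.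
have vT : 0 <= vmeas T by rewrite -lee_fin -vlebE// vleb_ge0.
have vTh : 0 <= vmeas Th by rewrite -lee_fin -vlebE// vleb_ge0.
apply: (le_trans h1); rewrite -/a.
have -> : a + M%:R^-1 = (M%:R * a + 1) / M%:R by field; rewrite gt_eqF.
apply: (@le_trans _ _ (N%:R / M%:R * vmeas Th)).
  by rewrite -mulrA ler_pM2l// [_^-1 * _]mulrC ler_pdivlMr// mulrC.
by rewrite ler_wpM2r// ler_pM2r// invr_gt0.
Qed.

(** Let k tend to infinity in [vmeas_sweep_thicken].  The exact value is
    |dot eta n| times the measure of the right prism. *)
Lemma vmeas_sweep_flat (R : realType) (l : nat) (S : set 'rV[R]_l)
    (n eta : 'rV[R]_l) (c : R) : (0 < l)%N -> compact S ->
  dot n n = 1 -> (forall y, S y -> dot y n = c) ->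
  vmeas (sweep S eta) <= l%:R * `|eta| * vmeas (prism S n).
Proof.
move=> l0 cS nn Sc.
have cP : compact (prism S n) by rewrite prism_sweep; exact: compact_sweep.
have : (fun k => (l%:R * `|eta| + k.+1%:R^-1) *
    vmeas (thicken (prism S n) k.+1%:R^-1)) @ \oo -->
    (l%:R * `|eta| + 0) * vmeas (prism S n).
  apply: cvgM; last exact: cvg_vmeas_thicken.
  by apply: cvgD; [exact: cvg_cst|exact: cvg_harmonic].
rewrite addr0 => /cvgr_to_ge; apply.
by near=> k; exact: (vmeas_sweep_thicken eta k l0 cS nn Sc).
Unshelve. all: by end_near. Qed.

Lemma vmeas_sweep (R : realType) (l : nat) (S : set 'rV[R]_l) (eta : 'rV[R]_l) :
  (0 < l)%N -> compact S -> flat S ->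
  vmeas (sweep S eta) <= l%:R * `|eta| * smeas S.
Proof.
move=> l0 cS /(xgetPex 0)[nn [c Sc]].
exact: vmeas_sweep_flat Sc.
Qed.

(** * Time steps *)

Lemma time_index_le (R : realType) (dt t : R) (n : nat) : 0 < dt -> 0 < t ->
  (time_index dt t <= n)%N = (t <= n%:R * dt).
Proof.
move=> dt0 t0; have q0 : 0 < t / dt by rewrite divr_gt0.
rewrite /time_index -lez_nat gez0_abs; last first.
  by rewrite ceil_ge0 (lt_trans _ q0)// oppr_lt0.
by rewrite ceil_le_int -ler_pdivrMr.
Qed.

Lemma measurable_time_index (R : realType) (dt : R) (H : nat -> \bar R) :
  0 < dt -> measurable_fun setT
    (fun t : measurableTypeR R => H (time_index dt t)).
Proof.
move=> dt0 _ Y mY; rewrite setTI.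
have E : (fun t => H (time_index dt t)) @^-1` Y =
    \bigcup_(n in [set n | Y (H n)]) [set t | time_index dt t = n].
  apply/seteqP; split=> t /=; last by move=> [n Yn ->].
  by move=> Yt; exists (time_index dt t).
rewrite E; apply: bigcup_measurable => n _.
have mc (z : int) :
    measurable ([set t | Num.ceil (t / dt) = z] : set (measurableTypeR R)).
  rewrite (_ : mkset _ = `]((z - 1)%:~R * dt), (z%:~R * dt)]%classic)//.
  apply/seteqP; split=> t /=; rewrite in_itv/= -ltr_pdivlMr// -ler_pdivrMr//.
    by move/eqP; rewrite ceil_eq.
  by rewrite -ceil_eq => /eqP.
have -> : [set t | time_index dt t = n] =
    [set t | Num.ceil (t / dt) = n%:Z] `|` [set t | Num.ceil (t / dt) = - n%:Z].
  apply/seteqP; split=> t /=; last by rewrite /time_index => -[->|->]; rewrite ?abszN.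
  rewrite /time_index; case: (Num.ceil (t / dt)) => [k /= ->|k /= <-]; first by left.
  by right; rewrite NegzE.
by apply: measurableU; exact: mc.
Qed.

(** The length of the intersection of the intervals [0, tau] and [0, x], and
    0 if x <= 0. *)
Definition clamp (R : realType) (tau x : R) : R := Num.min tau (Num.max 0 x).

Lemma overlap_le (R : realType) (q tau a d : R) : 0 < tau -> 0 < d ->
  (lebesgue_measure (`](q - tau)%R, q]%classic `&` `]a, (a + d)%R]%classic
     : set (measurableTypeR R))
   <= (clamp tau (q - a) - clamp tau (q - a - d))%:E)%E.
Proof.
move=> tau0 d0.
have -> : `](q - tau), q]%classic `&` `]a, (a + d)]%classic =
    `](Num.max (q - tau) a), (Num.min q (a + d))]%classic.
  apply/seteqP; split=> x /=; rewrite !in_itv/= gt_max le_min.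
    by move=> [/andP[-> ->] /andP[-> ->]].
  by move=> /andP[/andP[-> ->] /andP[-> ->]].
rewrite lebesgue_measure_oc lee_fin ge_max.
have h1 : Num.min q (a + d) <= q by rewrite ge_min lexx.
have h2 : Num.min q (a + d) <= a + d by rewrite ge_min lexx orbT.
have h3 : q - tau <= Num.max (q - tau) a by rewrite le_max lexx.
have h4 : a <= Num.max (q - tau) a by rewrite le_max lexx orbT.
move: (Num.min q _) (Num.max _ a) h1 h2 h3 h4 => y z h1 h2 h3 h4.
have cE x : clamp tau x = if x <= 0 then 0 else if tau <= x then tau else x.
  by rewrite /clamp; case: (leP 0 x) => x0; case: ifP => x1; case: leP; lra.
rewrite !cE; case: (leP (q - a) 0) => c1; case: (leP tau (q - a)) => c2;
case: (leP (q - a - d) 0) => c3; case: (leP tau (q - a - d)) => c4;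
by apply/andP; split; lra.
Qed.

(** The sum telescopes: the steps of length [d] tile the line, and their
    traces on an interval of length [tau] have total length at most [tau]. *)
Lemma clamp_sum (R : realType) (tau a d : R) (N : nat) : 0 < tau ->
  \sum_(n < N) (clamp tau (n%:R * d - a) - clamp tau (n%:R * d - a - d)) <= tau.
Proof.
move=> tau0; pose G (n : nat) := clamp tau (n%:R * d - a - d).
have -> : \sum_(n < N) (clamp tau (n%:R * d - a) - clamp tau (n%:R * d - a - d)) =
    \sum_(0 <= n < N) (G n.+1 - G n).
  rewrite big_mkord; apply: eq_bigr => n _; rewrite /G -natr1.
  by congr (clamp _ _ - _); ring.
rewrite telescope_sumr//.
have G0 n : 0 <= G n by rewrite /G /clamp le_min le_max lexx ltW.
have Gt n : G n <= tau by rewrite /G /clamp ge_min lexx.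
by have := G0 0%N; have := Gt N; lra.
Qed.

(** The time level n dt lies in [t, t + tau) exactly when t lies in
    a half-open interval of length [tau]. *)
Lemma sum_indicator_time (R : realType) (dt : R) (X : nat -> R) (t tau : R)
    (N : nat) : 0 < dt -> 0 < t -> 0 < tau ->
  (time_index dt (t + tau) <= N)%N ->
  \sum_(time_index dt t <= n < time_index dt (t + tau)) X n =
  \sum_(n < N) X n * \1_(`](n%:R * dt - tau), (n%:R * dt)]%classic) t.
Proof.
move=> dt0 t0 tau0 nN; rewrite (big_nat_widenl _ 0%N)// (big_nat_widen _ _ N)//.
rewrite big_mkord big_mkcond; apply: eq_bigr => n _ /=; rewrite indicE.
have -> : (t \in `](n%:R * dt - tau), (n%:R * dt)]%classic) =
    (time_index dt t <= n)%N && (n < time_index dt (t + tau))%N.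
  rewrite time_index_le// ltnNge time_index_le ?addr_gt0// -ltNge.
  by rewrite mem_setE in_itv/= ltrBlDr andbC.
by case: ifP; rewrite ?mulr1 ?mulr0.
Qed.

(** A positive time lies in one of the steps of the grid, so the value at
    its index is one of the terms of the sum. *)
Lemma time_index_indicator (R : realType) (dt : R) (X : nat -> R) (t a : R)
    (N : nat) : 0 < dt ->
  (forall j, 0 <= X j) -> 0 < t + a -> (time_index dt (t + a) <= N)%N ->
  X (time_index dt (t + a)) <=
  \sum_(j < N) X j.+1 * \1_(`](j%:R * dt - a), (j%:R * dt - a + dt)]%classic) t.
Proof.
move=> dt0 X0 ta0 nN; set n := time_index _ _ in nN *.
have n0 : (0 < n)%N by rewrite ltnNge /n time_index_le// mul0r -ltNge.
have n1N : (n.-1 < N)%N by rewrite prednK.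
rewrite (bigD1 (Ordinal n1N))//= prednK// indicE mem_set; last first.
  rewrite /= in_itv/=; have h1 : (n <= n.-1.+1)%N by rewrite prednK.
  have h2 : ~~ (n <= n.-1)%N by rewrite -ltnNge prednK.
  rewrite /n time_index_le// -/n -natr1 in h1.
  rewrite /n time_index_le// -/n -ltNge in h2.
  by rewrite ltrBlDr h2/=; lra.
rewrite mulr1 lerDl sumr_ge0// => j _; exact: mulr_ge0.
Qed.

(** * Diameters, chains and segments *)

Lemma diam_ub (R : realType) (l : nat) (A : set 'rV[R]_l) x y :
  bounded_set A -> A x -> A y -> `|x - y| <= diam A.
Proof.
move=> /bounded_cubeP[w w0 Aw] Ax Ay; apply: le_trans (norm_le_enorm _) _.
apply: ub_le_sup; last by exists x, y.
exists (l%:R * (w + w)) => _ [a [b [/Aw + /Aw + ->]]].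
rewrite /cube/= !subr0 => ha hb; apply: le_trans (enorm_le_norm _) _.
by rewrite ler_wpM2l//; apply: le_trans (ler_normB _ _) _; exact: lerD.
Qed.

Lemma diam_le (R : realType) (l : nat) (A : set 'rV[R]_l) w : A !=set0 ->
  A `<=` cube 0 w -> diam A <= l%:R * (w + w).
Proof.
move=> [z Az] Aw; apply: ge_sup; first by exists (enorm (z - z)), z, z.
move=> _ [a [b [/Aw + /Aw + ->]]].
rewrite /cube/= !subr0 => ha hb; apply: le_trans (enorm_le_norm _) _.
by rewrite ler_wpM2l//; apply: le_trans (ler_normB _ _) _; exact: lerD.
Qed.

Lemma diam_closure (R : realType) (l : nat) (A : set 'rV[R]_l) x y :
  bounded_set A -> A x -> closure A y -> `|x - y| <= diam A.
Proof.
move=> bA Ax Ay; apply/ler_addgt0Pr => e e0.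
have [z [Az yz]] := Ay _ (nbhsx_ballx y e e0).
move: yz; rewrite -ball_normE /ball_/= => yz.
rewrite (_ : x - y = (x - z) + (z - y)); last by rewrite addrA subrK.
apply: le_trans (ler_normD _ _) _; apply: lerD; first exact: diam_ub.
by rewrite distrC ltW.
Qed.

Lemma closed_cube (R : realType) (l : nat) (c : 'rV[R]_l) w : closed (cube c w).
Proof.
rewrite -openC; apply/open_ballP => x /negP; rewrite -ltNge => xw.
exists (`|x - c| - w); first by rewrite subr_gt0.
move=> y yx; apply/negP; rewrite -ltNge.
have : `|x - c| <= `|x - y| + `|y - c|.
  by rewrite (_ : x - c = (x - y) + (y - c)) ?ler_normD// addrA subrK.
rewrite distrC in yx => h; rewrite ltrBrDr in yx.
by rewrite -(ltrD2l `|x - y|); exact: lt_le_trans yx h.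
Qed.

Lemma compact_closure (R : realType) (l : nat) (A : set 'rV[R]_l) :
  bounded_set A -> compact (closure A).
Proof.
move=> /bounded_cubeP[w w0 Aw].
apply: bounded_closed_compact; last exact: closed_closure.
apply/bounded_cubeP; exists w => // z /(closure_subset Aw).
by have <- := (closure_id _).1 (closed_cube (c := 0) (w := w)).
Qed.

Lemma sqr_add_le (R : realType) (N a b S : R) : 0 < N -> b ^+ 2 <= N * S ->
  (a + b) ^+ 2 <= (N + 1) * (a ^+ 2 + S).
Proof.
move=> N0 hb.
(* Cauchy-Schwarz for the weights N and 1, as a completed square. *)
have : 0 <= (N * a - b) ^+ 2 / N by rewrite divr_ge0// ?sqr_ge0// ltW.
have -> : (N * a - b) ^+ 2 / N = N * a ^+ 2 - 2 * a * b + b ^+ 2 / N.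
  by field; rewrite gt_eqF.
have : b ^+ 2 / N <= S by rewrite ler_pdivrMr// mulrC.
by move=> h1 h2; lra.
Qed.

(** Cauchy-Schwarz along the path, in the inductive form [sqr_add_le]. *)
Lemma sqr_path_le (R : realType) (T : finType) (v : T -> R) (x : T) (p : seq T) :
  (v x - v (last x p)) ^+ 2 <=
  (size p)%:R * \sum_(q <- zip (x :: p) p) (v q.1 - v q.2) ^+ 2.
Proof.
elim: p x => [|y p IH] x; first by rewrite big_nil mulr0 /= subrr expr0n.
rewrite /= big_cons /=; have := IH y; set S := \sum_(_ <- _) _.
set b := v y - v _; set a := v x - v y => hb.
have -> : v x - v (last y p) = a + b by rewrite addrA subrK.
have S0 : 0 <= S by apply: sumr_ge0 => q _; exact: sqr_ge0.
rewrite -natr1; case: (size p) hb => [|n] hb.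
  have : b ^+ 2 = 0.
    by apply/eqP; rewrite eq_le sqr_ge0 andbT; move: hb; rewrite mul0r.
  by move=> /eqP; rewrite sqrf_eq0 => /eqP ->; rewrite addr0 add0r mul1r lerDl.
by apply: sqr_add_le => //; rewrite ltr0n.
Qed.

(** A path can be shortened to a simple one.  Its vertices after the first
    are distinct targets of [e], hence at most [#|S|] in number, and its edges
    are distinct, so that their sum is part of the sum over all edges. *)
Lemma sqr_connect_le (R : realType) (T : finType) (e : rel T) (v : T -> R)
    (S : {set T}) (x y : T) : (forall a b, e a b -> b \in S) -> connect e x y ->
  (v x - v y) ^+ 2 <=
  #|S|%:R * \sum_(q : T * T | e q.1 q.2) (v q.1 - v q.2) ^+ 2.
Proof.
move=> eS /connectP[p0 ep0 ->].
case: (shortenP ep0) => p ep up _ {p0 ep0}.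
apply: le_trans (sqr_path_le v x p) _.
have pS : {subset p <= S}.
  elim: p x ep {up} => // b p IH a /= /andP[eab ep] c; rewrite inE => /orP[/eqP->|].
    exact: eS eab.
  exact: (IH _ ep).
have zE : all (fun q => e q.1 q.2) (zip (x :: p) p).
  by elim: p x ep {up pS} => //= b p IH a /andP[-> /IH].
have zU : uniq (zip (x :: p) p) by exact: zip_uniql.
apply: ler_pM => //.
- by apply: sumr_ge0 => q _; exact: sqr_ge0.
- rewrite ler_nat cardE; apply: uniq_leq_size => [|c cp]; first by case/andP: up.
  by rewrite mem_enum; exact: pS.
- rewrite big_uniq//= big_mkcond [leRHS]big_mkcond/=; apply: ler_sum => q _.
  case: ifPn => [qz|_]; last by case: ifP => // _; exact: sqr_ge0.
  by rewrite (allP zE).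
Qed.

(** A segment is not the disjoint union of two nonempty closed sets. *)
Lemma segment_closed_cover (R : realType) (P Q : set R) : closed P -> closed Q ->
  (forall s, 0 <= s <= 1 -> P s -> ~ Q s) ->
  (forall s, 0 <= s <= 1 -> P s \/ Q s) -> P 0 -> ~ Q 1.
Proof.
move=> cP cQ disj cov P0 Q1.
have i01 : 0 <= (1 : R) <= 1 by rewrite ler01 lexx.
suff E : `[0, 1]%classic `&` P = `[0, 1]%classic.
  have : (`[0, 1]%classic `&` P) (1 : R) by rewrite E/= in_itv.
  by move=> [_ /disj]; apply.
apply: (@segment_connected R 0 1).
- by exists 0; split => //=; rewrite in_itv/= lexx ler01.
- exists (~` Q); first exact: closed_openC.
  apply/seteqP; split=> s [/= s01 h1]; split => //; rewrite in_itv/= in s01.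
    exact: disj h1.
  by have [] := cov _ s01.
- by exists P.
Qed.

Lemma bounded_sub (R : realType) (l : nat) (A B : set 'rV[R]_l) : bounded_set B ->
  A `<=` B -> bounded_set A.
Proof.
move=> /bounded_cubeP[w w0 Bw] AB; apply/bounded_cubeP; exists w => //.
exact: subset_trans Bw.
Qed.

Lemma smeas_ge0 (R : realType) (l : nat) (S : set 'rV[R]_l) : 0 <= smeas S.
Proof. by rewrite /smeas /vmeas fine_ge0. Qed.

Lemma vmeas_ge0 (R : realType) (l : nat) (S : set 'rV[R]_l) : 0 <= vmeas S.
Proof. by rewrite /vmeas fine_ge0. Qed.

Lemma smeas_set0 (R : realType) (l : nat) : smeas (@set0 'rV[R]_l) = 0.
Proof.
rewrite /smeas /vmeas (_ : prism set0 _ = set0) ?preimage_set0 ?measure0//.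
by rewrite -subset0 => x [y [t []]].
Qed.

(** * Geometry of an admissible mesh *)

Section mesh_geometry.
Context (R : realType) (l : nat) (Omega : set 'rV[R]_l) (alpha : R) (m : mesh R l).
Hypotheses (l0 : (0 < l)%N) (oO : open Omega) (bO : bounded_set Omega)
  (al0 : 0 < alpha) (am : admissible_mesh Omega alpha m).
Implicit Types (K L : cell m) (w : cell m -> R) (eta : 'rV[R]_l).

Let h := mesh_size m.

Lemma vol_open K : open (vol K).
Proof. by have [] := am_polygonal am K. Qed.

Lemma bounded_vol K : bounded_set (vol K).
Proof. exact: bounded_sub bO (@am_sub _ _ _ _ _ am K). Qed.

Lemma compact_face K L : compact (face K (inl L)).
Proof.
apply: (@subclosed_compact _ _ (closure (vol K))) => [||x []//].
  by apply: closedI; exact: closed_closure.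
by apply: compact_closure; exact: bounded_vol.
Qed.

Lemma faceC K L : face K (inl L) = face L (inl K).
Proof. by rewrite /= setIC. Qed.

Lemma nbC K L : nb K L = nb L K.
Proof. by rewrite /nb eq_sym faceC. Qed.

Lemma vmeasurable_vol K : vmeasurable (vol K).
Proof. by apply: open_vmeasurable; exact: vol_open. Qed.

Lemma vol_inj K L x : vol K x -> vol L x -> K = L.
Proof.
move=> Kx Lx; apply/eqP/negP => /negP KL.
by have := am_disjoint am KL; rewrite -subset0 => /(_ x); apply.
Qed.

Lemma piecewise_in w K x : vol K x -> piecewise w x = w K.
Proof.
move=> Kx; rewrite /piecewise (bigD1 K)/=; last exact: mem_set.
rewrite big1 ?addr0// => L /andP[/set_mem Lx].
by rewrite (vol_inj Lx Kx) eqxx.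
Qed.

Lemma piecewise_out w x : (forall K, ~ vol K x) -> piecewise w x = 0.
Proof.
by move=> xK; rewrite /piecewise big1// => K /set_mem /xK.
Qed.

Lemma piecewise_comp (g : R -> R) w x : g 0 = 0 ->
  g (piecewise w x) = piecewise (fun K => g (w K)) x.
Proof.
move=> g0; have [[K Kx]|nK] := pselect (exists K, vol K x).
  by rewrite !(piecewise_in _ Kx).
by rewrite !piecewise_out// => K Kx; apply: nK; exists K.
Qed.

Lemma diam_vol K : diam (vol K) <= h.
Proof. exact: le_bigmax. Qed.

Lemma mesh_size_ge0 : 0 <= h.
Proof. exact: bigmax_ge_id. Qed.

Lemma mesh_size_le r : 0 <= r -> Omega `<=` cube 0 r -> h <= l%:R * (r + r).
Proof.
move=> r0 Or; apply: bigmax_le => [|K _]; first by rewrite mulr_ge0// addr_ge0.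
apply: diam_le; first by exists (pt K); exact: am_pt am K.
by apply: subset_trans Or; exact: am_sub am K.
Qed.

Lemma vol_closure_le K x y : vol K x -> closure (vol K) y -> `|x - y| <= h.
Proof.
move=> Kx Ky; apply: le_trans (diam_vol K).
by apply: diam_closure => //; exact: bounded_vol.
Qed.

Lemma nb_face K L : nb K L -> face K (inl L) !=set0.
Proof.
move=> /andP[_]; apply: contraPP => /set0P/negP/negPn/eqP ->.
by rewrite smeas_set0 ltxx.
Qed.

Lemma dist_le K L : nb K L -> dist K L <= l%:R * (2 * h).
Proof.
move=> /nb_face[y [Ky Ly]]; apply: le_trans (enorm_le_norm _) _.
rewrite ler_wpM2l// (_ : pt K - pt L = (pt K - y) - (pt L - y)); last first.
  by rewrite opprB addrA subrK.
apply: le_trans (ler_normB _ _) _; rewrite mulr_natl mulr2n.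
apply: lerD; first exact: (vol_closure_le (am_pt am K)).
exact: (vol_closure_le (am_pt am L)).
Qed.

Lemma dist_gt0 K L : nb K L -> 0 < dist K L.
Proof.
move=> /andP[KL _]; apply: lt_le_trans (norm_le_enorm _).
rewrite normr_gt0 subr_eq0; apply/eqP => E.
have := am_pt am K; rewrite E => /(vol_inj (am_pt am L)) LK.
by rewrite LK eqxx in KL.
Qed.

Lemma distC K L : dist K L = dist L K.
Proof.
rewrite /dist /enorm; congr Num.sqrt; rewrite /dot; apply: eq_bigr => i _.
by rewrite !mxE; ring.
Qed.

Lemma mesh_size_gt0 K L : nb K L -> 0 < h.
Proof.
move=> KL; have := lt_le_trans (dist_gt0 KL) (dist_le KL).
by rewrite pmulr_rgt0 ?ltr0n// pmulr_rgt0.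
Qed.

Definition touched x eta : {set cell m} :=
  [set K | `[< exists2 s : R, 0 <= s <= 1 &
                 closure (vol K) (x + s *: eta) >]]%SET.

(** Each touched volume lies within distance 2 h of one of about |eta| / h
    points spaced by at most h along the segment.  The volumes are disjoint
    and of measure at least alpha h^l, whereas the cubes of radius 2 h around
    these points have measure (4 h)^l. *)
Lemma card_touched x eta : 0 < h ->
  #|touched x eta|%:R * h <= 4 ^+ l / alpha * (`|eta| + 2 * h).
Proof.
move=> h0; have hn0 : h != 0 by rewrite gt_eqF.
pose N := (Num.trunc (`|eta| / h)).+1.
have N0 : 0 < N%:R :> R by rewrite ltr0n.
have eh0 : 0 <= `|eta| / h by rewrite divr_ge0// ltW.
have eN : `|eta| < N%:R * h by rewrite -ltr_pdivrMr//; exact: truncnS_gt.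
have Ne : N%:R <= `|eta| / h + 1.
  by rewrite /N -addn1 natrD lerD2r; have /andP[] := truncn_itv eh0.
pose c (i : 'I_N) := cube (x + (i%:R / N%:R) *: eta) (2 * h).
have h20 : 0 <= 2 * h by rewrite mulr_ge0// ltW.
pose A := \bigcup_(i in [set: 'I_N]) c i.
have mA : vmeasurable A.
  rewrite /vmeasurable preimage_bigcup; apply: fin_bigcup_measurable => // i _.
  exact: vmeasurable_cube.
(* Empty unless K is touched, so that all volumes index one disjoint family. *)
pose V K : set 'rV[R]_l := if K \in touched x eta then vol K else set0.
have mV K : vmeasurable (V K).
  rewrite /V; case: ifP => _; first exact: vmeasurable_vol.
  by rewrite /vmeasurable preimage_set0.
have VA K : V K `<=` A.
  rewrite /V; case: ifPn => [|_]; last exact: sub0set.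
  rewrite inE => /asboolP[s s01 Ks] y Ky.
  have /andP[s0 s1] := s01.
  have [i ilo ihi] := unit_grid (ltn0Sn _) s0 s1 : exists2 i : 'I_N, _ & _.
  exists i => //; rewrite /c/cube/=.
  rewrite (_ : y - _ = (y - (x + s *: eta)) + (s - i%:R / N%:R) *: eta); last first.
    by rewrite scalerBl !opprD !addrA subrK.
  apply: le_trans (ler_normD _ _) _; rewrite [leRHS]mulr_natl mulr2n; apply: lerD.
    exact: (vol_closure_le Ky Ks).
  rewrite normrZ ger0_norm ?subr_ge0 ?ler_pdivrMr//.
  apply: (@le_trans _ _ (N%:R^-1 * `|eta|)).
    rewrite ler_wpM2r// lerBlDl -[X in _ + X]mul1r -mulrDl ler_pdivlMr//.
  by rewrite mulrC ler_pdivrMr// mulrC ltW.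
have : (\sum_K vleb (V K) <= \sum_i vleb (c i))%E.
  apply: (@le_trans _ _ (vleb A)).
    apply: sum_vleb_le => // K L y.
    by rewrite /V; case: ifP => // _; case: ifP => // _; exact: vol_inj.
  apply: vleb_sub_sum => // [i|y [i _ ciy]]; first exact: vmeasurable_cube.
  by exists i.
have -> : (\sum_i vleb (c i) = (((2 * (2 * h)) ^+ l) *+ N)%:E)%E.
  rewrite (eq_bigr (fun=> ((2 * (2 * h)) ^+ l)%:E)) => [|i _]; last first.
    exact: vleb_cube.
  by rewrite sumEFin sumr_const card_ord.
have : ((#|touched x eta|%:R * (alpha * h ^+ l))%:E <= \sum_K vleb (V K))%E.
  rewrite (bigID (mem (touched x eta)))/=.
  rewrite [X in (_ + X)%E]big1 => [|K /negPf xK]; last first.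
    by rewrite /V xK /vleb preimage_set0 measure0.
  rewrite adde0 mulr_natl -sumr_const -sumEFin; apply: lee_sum => K xK.
  rewrite /V xK vlebE ?lee_fin.
  - exact: am_vol am K.
  - exact: vmeasurable_vol.
  - exact: bounded_vol.
move=> /le_trans /[apply]; rewrite lee_fin -[X in _ <= X]mulr_natl.
rewrite (_ : 2 * (2 * h) = 4 * h); last by ring.
rewrite exprMn => H.
have hl0 : 0 < h ^+ l by rewrite exprn_gt0.
have {}H : #|touched x eta|%:R * alpha <= N%:R * 4 ^+ l.
  by rewrite -(ler_pM2r hl0) -!mulrA.
rewrite -mulrA mulrCA -(ler_pM2r al0) [alpha^-1 * _]mulrC -!mulrA.
rewrite mulVf ?gt_eqF// mulr1 [h * _]mulrC mulrA.
apply: (@le_trans _ _ (N%:R * 4 ^+ l * h)); first by rewrite ler_pM2r.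
rewrite mulrC mulrA mulrC ler_wpM2l ?exprn_ge0//.
have : h * N%:R <= h * (`|eta| / h + 1) by rewrite ler_pM2l.
have -> : h * (`|eta| / h + 1) = `|eta| + h by field.
by lra.
Qed.

(** * Space translates of a discrete function *)

(** The graph on the control volumes whose edges are the interfaces of
    positive measure met by the segment. *)
Definition crossing x eta : rel (cell m) :=
  fun K L => nb K L && `[< sweep (face K (inl L)) eta x >].

Lemma crossing_touched x eta K L : crossing x eta K L -> L \in touched x eta.
Proof.
move=> /andP[_ /asboolP[s s01 [_ Ls]]].
by rewrite inE; apply/asboolP; exists s.
Qed.

Lemma closed_preimage_segment x eta K :
  closed [set s : R | closure (vol K) (x + s *: eta)].
Proof.
have cg : continuous (fun s : R => x + s *: eta).
  by move=> s; apply: cvgD; [exact: cvg_cst|apply: cvgZr_tmp; exact: cvg_id].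
apply: (@closed_comp _ _ (fun s : R => x + s *: eta)) => [s _|]; first exact: cg.
exact: closed_closure.
Qed.

(** The parameters s for which x + s eta lies in the closure of a volume
    reachable from K0, respectively not reachable, form two closed sets that
    cover [0, 1].  A common s gives a point of the segment on an interface
    between a reachable volume and one that is not; this interface has
    positive measure by hypothesis, so it is an edge of the graph, which is
    absurd. *)
Lemma crossing_connect x eta K0 K1 :
  (forall s : R, 0 <= s <= 1 -> Omega (x + s *: eta)) ->
  (forall K L, K != L -> ~~ nb K L -> ~ sweep (face K (inl L)) eta x) ->
  closure (vol K0) x -> closure (vol K1) (x + eta) ->
  connect (crossing x eta) K0 K1.
Proof.
move=> segO Hnb K0x K1x; set e := crossing x eta.
apply: contrapT => nK1.
pose C K := [set s : R | closure (vol K) (x + s *: eta)].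
pose CQ := \bigcup_(K in [set K | connect e K0 K]) C K.
pose CN := \bigcup_(K in [set K | ~ connect e K0 K]) C K.
have cQ : closed CQ.
  apply: closed_bigcup => [|K _]; last exact: closed_preimage_segment.
  exact: (@sub_finite_set _ _ [set: cell m]).
have cN : closed CN.
  apply: closed_bigcup => [|K _]; last exact: closed_preimage_segment.
  exact: (@sub_finite_set _ _ [set: cell m]).
have disj s : 0 <= s <= 1 -> CQ s -> ~ CN s.
  move=> s01 [K /= KQ Ks] [L /= LN Ls].
  have KL : K != L.
    by apply/eqP => KL; apply: LN; rewrite -KL.
  have fs : sweep (face K (inl L)) eta x by exists s.
  apply: LN; apply: connect_trans KQ (connect1 _).
  apply/andP; split; last exact/asboolP.
  by apply: contraPT fs; exact: Hnb.
have cov s : 0 <= s <= 1 -> CQ s \/ CN s.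
  clear cQ cN disj; move=> s01.
  have : closure Omega (x + s *: eta) by apply: subset_closure; exact: segO.
  rewrite -(am_cover am) => -[K _ Ks].
  by have [cK|cK] := pselect (connect e K0 K); [left|right]; exists K.
have CQ0 : CQ 0 by exists K0; [exact: connect0|rewrite /C/= scale0r addr0].
have CN1 : CN 1 by exists K1; [exact: nK1|rewrite /C/= scale1r].
exact: (segment_closed_cover cQ cN disj cov CQ0 CN1).
Qed.

(** The starting points excluded because of the pair p = (K, L): an end of
    the segment lies on the common boundary of K and L, or the segment meets
    this boundary and its surface measure is zero. *)
Definition negligible_pair eta (p : cell m * cell m) : set 'rV[R]_l :=
  if p.1 == p.2 then set0 else
  face p.1 (inl p.2) `|` [set x | face p.1 (inl p.2) (x + eta)] `|`
  (if nb p.1 p.2 then set0 else sweep (face p.1 (inl p.2)) eta).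

Definition negligible_start eta : set 'rV[R]_l :=
  \bigcup_(p in [set: cell m * cell m]) negligible_pair eta p.

(** A flat set is the oblique prism over itself for [eta = 0]. *)
Lemma vleb_face K L : K != L -> vleb (face K (inl L)) = 0%E.
Proof.
have cf := @compact_face K L => KL.
rewrite vlebE; [|exact: compact_vmeasurable|exact: compact_bounded].
congr (_%:E); apply/eqP; rewrite eq_le vmeas_ge0 andbT.
have := vmeas_sweep 0 l0 (@compact_face K L) (am_interface am KL).
rewrite normr0 mulr0 mul0r (_ : sweep _ 0 = face K (inl L))//.
apply/seteqP; split=> x /=; first by move=> [s _]; rewrite scaler0 addr0.
by exists 0; rewrite ?lexx ?ler01// scaler0 addr0.
Qed.

Lemma vleb_sweep_face eta K L : K != L ->
  (vleb (sweep (face K (inl L)) eta) <=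
   (l%:R * `|eta| * smeas (face K (inl L)))%:E)%E.
Proof.
move=> KL; have cS := @compact_sweep _ _ _ eta (@compact_face K L).
rewrite vlebE; [|exact: compact_vmeasurable|exact: compact_bounded].
rewrite lee_fin.
exact: (vmeas_sweep eta l0 (@compact_face K L) (am_interface am KL)).
Qed.

Lemma vmeasurable_negligible_pair eta p : vmeasurable (negligible_pair eta p).
Proof.
rewrite /negligible_pair; case: ifP => [_|_].
  by rewrite /vmeasurable preimage_set0.
have mf := compact_vmeasurable (@compact_face p.1 p.2).
rewrite /vmeasurable !preimage_setU; apply: measurableU; first apply: measurableU.
- exact: mf.
- exact: (vmeasurable_translation eta mf).
case: ifP => _; first by rewrite preimage_set0.
by apply: compact_vmeasurable; apply: compact_sweep; exact: compact_face.
Qed.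

Lemma vleb_negligible_pair eta p : vleb (negligible_pair eta p) = 0%E.
Proof.
rewrite /negligible_pair; case: ifPn => [_|KL].
  by rewrite /vleb preimage_set0 measure0.
have mf := compact_vmeasurable (@compact_face p.1 p.2).
have f0 := vleb_face KL.
apply: (@measure_negligible _ _ _ (leb R l)).
  have := vmeasurable_negligible_pair eta p.
  by rewrite /negligible_pair (negPf KL).
apply: negligibleU; first apply: negligibleU.
- by apply/negligibleP => //; exact: f0.
- apply/negligibleP; first exact: (vmeasurable_translation eta mf).
  exact: etrans (vleb_translation eta mf) f0.
case: ifPn => [_|nKL].
  by apply: (negligibleS _ (negligible_set0 _)) => t.
apply/negligibleP.
  by apply: compact_vmeasurable; apply: compact_sweep; exact: compact_face.
have := vleb_sweep_face eta KL.
have -> : smeas (face p.1 (inl p.2)) = 0.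
  by apply/eqP; rewrite eq_le smeas_ge0 andbT leNgt; move: nKL; rewrite /nb KL.
by rewrite mulr0 => h1; apply/eqP; rewrite eq_le measure_ge0 andbT.
Qed.

Lemma vmeasurable_negligible eta : vmeasurable (negligible_start eta).
Proof.
rewrite /vmeasurable preimage_bigcup; apply: fin_bigcup_measurable => // p _.
exact: vmeasurable_negligible_pair.
Qed.

Lemma vleb_negligible eta : vleb (negligible_start eta) = 0%E.
Proof.
apply/eqP; rewrite eq_le vleb_ge0 andbT.
apply: le_trans (vleb_sub_sum (F := negligible_pair eta) _ _ _) _.
- exact: vmeasurable_negligible.
- by move=> p; exact: vmeasurable_negligible_pair.
- by move=> x [p _ px]; exists p.
- by rewrite big1// => p _; exact: vleb_negligible_pair.
Qed.

(** A point of Omega in the closure of K but not in K is on an edge of K,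
    which is not on the boundary of Omega because Omega is open. *)
Lemma Omega_vol x : Omega x -> (forall K L, K != L -> ~ face K (inl L) x) ->
  exists K, vol K x.
Proof.
move=> Ox nf.
have : closure Omega x by exact: subset_closure.
rewrite -(am_cover am) => -[K _ Kx]; exists K; apply: contrapT => nK.
have : bd (vol K) x.
  split => //; have := @vol_open K; rewrite openE => oK.
  by move=> /interior_subset.
rewrite (am_bd am) => -[[L|b] /= e fx].
  by have /andP[KL _] := e; exact: (nf K L).
have [_ _ _ /(_ _ fx)[_]] := am_bface am b; apply.
by have := oO; rewrite openE; apply.
Qed.

(** A simple chain of crossings has at most #|touched| steps, and
    #|touched| h is bounded by [card_touched].  Inserting
    1 <= 2 l h / d_{K,L} in each term of the Cauchy-Schwarz bound turns the
    number of steps into #|touched| h and the jumps into weighted jumps. *)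
Lemma piecewise_shift_le w eta x : shifted Omega eta x ->
  ~ negligible_start eta x ->
  (piecewise w (x + eta) - piecewise w x) ^+ 2 <=
  4 ^+ l / alpha * (`|eta| + 2 * h) * (l%:R * 2) *
  \sum_(p : cell m * cell m | nb p.1 p.2)
    \1_(sweep (face p.1 (inl p.2)) eta) x * ((w p.2 - w p.1) ^+ 2 / dist p.1 p.2).
Proof.
move=> [Ox seg] nx.
have nf K L : K != L -> ~ face K (inl L) x.
  move=> KL fx; apply: nx; exists (K, L) => //.
  by rewrite /negligible_pair/= (negPf KL); left; left.
have nfe K L : K != L -> ~ face K (inl L) (x + eta).
  move=> KL fx; apply: nx; exists (K, L) => //.
  by rewrite /negligible_pair/= (negPf KL); left; right.
have ns K L : K != L -> ~~ nb K L -> ~ sweep (face K (inl L)) eta x.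
  move=> KL nKL fx; apply: nx; exists (K, L) => //.
  by rewrite /negligible_pair/= (negPf KL) (negPf nKL); right.
have [K0 K0x] := Omega_vol Ox nf.
have Oxe : Omega (x + eta).
  by have := seg 1; rewrite scale1r; apply; rewrite ler01 lexx.
have [K1 K1x] := Omega_vol Oxe nfe.
rewrite (piecewise_in w K0x) (piecewise_in w K1x).
have con := crossing_connect seg ns (subset_closure K0x) (subset_closure K1x).
set S := \sum_(_ | _) _.
have q0 K L : nb K L -> 0 <= (w L - w K) ^+ 2 / dist K L.
  by move=> nKL; rewrite divr_ge0// ?sqr_ge0// ltW// dist_gt0.
have S0 : 0 <= S by apply: sumr_ge0 => p np; rewrite mulr_ge0// q0.
have h0 := mesh_size_ge0.
have C0 : 0 <= 4 ^+ l / alpha * (`|eta| + 2 * h).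
  apply: mulr_ge0; first by rewrite divr_ge0// ?exprn_ge0// ltW.
  by rewrite addr_ge0// mulr_ge0.
have [->|K01] := eqVneq K0 K1.
  by rewrite subrr expr0n/= mulr_ge0// mulr_ge0// mulr_ge0.
have hp : 0 < h.
  have /connectP[[|L p] /= ep lp] := con; first by rewrite lp eqxx in K01.
  by have /andP[/andP[/mesh_size_gt0]] := ep.
have := sqr_connect_le w (@crossing_touched x eta) con.
rewrite -sqrrN opprB => /le_trans; apply.
set E := \sum_(_ | _) _.
have ES : E <= h * (l%:R * 2) * S.
  rewrite /E /S mulr_sumr big_mkcond [leRHS]big_mkcond/=.
  apply: ler_sum => -[K L] _ /=.
  rewrite /crossing; case: ifP => [/andP[nKL /asboolP KLx]|_]; last first.
    case: ifP => // nKL; apply: mulr_ge0; first by rewrite !mulr_ge0.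
    by rewrite mulr_ge0// q0.
  rewrite nKL indicE mem_set//= mul1r -sqrrN opprB mulrA.
  rewrite ler_pdivlMr ?dist_gt0// mulrC ler_wpM2r ?sqr_ge0//.
  by apply: le_trans (dist_le nKL) _; rewrite mulrA mulrC.
apply: (@le_trans _ _ (#|touched x eta|%:R * (h * (l%:R * 2) * S))).
  by rewrite ler_wpM2l.
have -> : #|touched x eta|%:R * (h * (l%:R * 2) * S) =
  (#|touched x eta|%:R * h) * (l%:R * 2) * S by ring.
by rewrite ler_wpM2r// ler_wpM2r ?mulr_ge0//; exact: card_touched.
Qed.

Lemma xint_shift_le w eta :
  (xint (shifted Omega eta) (fun x =>
     ((`|piecewise w (x + eta) - piecewise w x| ^+ 2)%R)%:E) <=
   (4 ^+ l / alpha * (`|eta| + 2 * h) * (l%:R * 2) * (l%:R * `|eta|) *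
    \sum_K \sum_(L | nb K L)
      smeas (face K (inl L)) / dist K L * (w L - w K) ^+ 2)%:E)%E.
Proof.
set C := 4 ^+ l / alpha * _ * _.
have C0 : 0 <= C.
  apply: mulr_ge0; last by rewrite mulr_ge0.
  apply: mulr_ge0; first by rewrite divr_ge0// ?exprn_ge0// ltW.
  by rewrite addr_ge0// mulr_ge0// mesh_size_ge0.
pose a (p : cell m * cell m) : R :=
  if nb p.1 p.2 then C * ((w p.2 - w p.1) ^+ 2 / dist p.1 p.2) else 0.
have a_ge0 p : 0 <= a p.
  rewrite /a; case: ifP => // np; rewrite mulr_ge0// divr_ge0// ?sqr_ge0// ltW//.
  exact: dist_gt0.
pose s (p : cell m * cell m) := sweep (face p.1 (inl p.2)) eta.
have ms p : vmeasurable (s p).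
  by apply: compact_vmeasurable; apply: compact_sweep; exact: compact_face.
apply: (@le_trans _ _ (\sum_(p : cell m * cell m) (a p)%:E * vleb (s p))%E).
  apply: (@le_integral_step _ _ _ _ _ (@vec R l @^-1` negligible_start eta)
    _ _ _ (fun p => @vec R l @^-1` s p)) => //.
  - exact: vmeasurable_negligible.
  - exact: vleb_negligible.
  - move=> t At Nt; rewrite lee_fin real_normK ?num_real//.
    apply: le_trans (piecewise_shift_le w At Nt) _.
    rewrite mulr_sumr big_mkcond; apply: ler_sum => p _; rewrite /a.
    case: ifP => _; last by rewrite mul0r.
    rewrite indic_vec -/C -/(s p).
    by rewrite le_eqVlt; apply/orP; left; apply/eqP; ring.
apply: (@le_trans _ _ (\sum_(p : cell m * cell m)
    (a p * (l%:R * `|eta| * smeas (face p.1 (inl p.2))))%:E)%E).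
  apply: lee_sum => p _.
  rewrite EFinM; have [KL|KL] := boolP (nb p.1 p.2); last first.
    by rewrite /a (negPf KL) !mul0e.
  apply: lee_wpmul2l; first by rewrite lee_fin.
  by apply: vleb_sweep_face; case/andP: KL.
rewrite sumEFin lee_fin (pair_big_dep xpredT (fun K L => nb K L))/=.
rewrite mulr_sumr [leRHS]big_mkcond/=; apply: ler_sum => -[K L] _ /=.
rewrite /a/=; case: ifP => _; last by rewrite mul0r.
rewrite le_eqVlt; apply/orP; left; apply/eqP; ring.
Qed.

(** * Discrete energy *)

Lemma vmeas_vol_le : \sum_(K : cell m) vmeas (vol K) <= vmeas Omega.
Proof.
have mO : vmeasurable Omega by exact: open_vmeasurable.
rewrite -lee_fin -vlebE// -sumEFin.
rewrite (eq_bigr (fun K => vleb (vol K))) => [|K _]; last first.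
  by rewrite vlebE//; [exact: vmeasurable_vol|exact: bounded_vol].
apply: sum_vleb_le => //; [exact: vmeasurable_vol|exact: am_sub am|exact: vol_inj].
Qed.

(** [discrete_H] squared, without the factor [l]. *)
Definition edge_energy w : R :=
  \sum_K \sum_(L | nb K L) transm K L * (w L - w K) ^+ 2.

(** What Young's inequality leaves over when a flux bounded by a multiple of
    m(K|L) is absorbed in the energy. *)
Definition diamond_sum : R :=
  \sum_(K : cell m) \sum_(L | nb K L) smeas (face K (inl L)) * dist K L.

Lemma transm_ge0 K L : nb K L -> 0 <= transm K L.
Proof. by move=> KL; rewrite divr_ge0 ?smeas_ge0// ltW// dist_gt0. Qed.

Lemma transmC K L : transm K L = transm L K.
Proof. by rewrite /transm faceC distC. Qed.

Lemma edge_energy_ge0 w : 0 <= edge_energy w.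
Proof.
apply: sumr_ge0 => K _; apply: sumr_ge0 => L KL.
by rewrite mulr_ge0 ?transm_ge0 ?sqr_ge0.
Qed.

Lemma edge_energyB v w : edge_energy (fun K => v K - w K) <=
  2 * edge_energy v + 2 * edge_energy w.
Proof.
rewrite /edge_energy !mulr_sumr -big_split/=; apply: ler_sum => K _.
rewrite !mulr_sumr -big_split/=; apply: ler_sum => L KL.
set a := v L - v K; set b := w L - w K.
have -> : v L - w L - (v K - w K) = a - b by rewrite /a /b; ring.
rewrite ![2 * (_ * _)]mulrCA -mulrDr ler_wpM2l ?transm_ge0//.
by have : 0 <= (a + b) ^+ 2 by [exact: sqr_ge0]; lra.
Qed.

Lemma diamond_sum_ge0 : 0 <= diamond_sum.
Proof.
apply: sumr_ge0 => K _; apply: sumr_ge0 => L KL.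
by rewrite mulr_ge0 ?smeas_ge0// ltW// dist_gt0.
Qed.

(** d_{K,L} <= 2 l h, the perimeter of K is at most h^(l-1) / alpha, and
    h^l <= m(K) / alpha. *)
Lemma diamond_sum_le :
  diamond_sum <= 2 * l%:R * alpha^-1 * alpha^-1 * vmeas Omega.
Proof.
have h0 := mesh_size_ge0.
have ai : 0 <= alpha^-1 by rewrite invr_ge0 ltW.
apply: (@le_trans _ _ (\sum_(K : cell m)
    2 * l%:R * alpha^-1 * alpha^-1 * vmeas (vol K))); last first.
  by rewrite -mulr_sumr ler_wpM2l ?vmeas_vol_le// !mulr_ge0.
apply: ler_sum => K _.
apply: (@le_trans _ _
    (\sum_(L | nb K L) smeas (face K (inl L)) * (l%:R * (2 * h)))).
  by apply: ler_sum => L KL; rewrite ler_wpM2l ?smeas_ge0// dist_le.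
rewrite -mulr_suml.
have p1 : \sum_(L | nb K L) smeas (face K (inl L)) <= alpha^-1 * h ^+ l.-1.
  apply: le_trans (am_perimeter am K).
  rewrite big_sumType/= lerDl.
  by apply: sumr_ge0 => b _; exact: smeas_ge0.
apply: (@le_trans _ _ (alpha^-1 * h ^+ l.-1 * (l%:R * (2 * h)))).
  by rewrite ler_wpM2r// !mulr_ge0.
have -> : alpha^-1 * h ^+ l.-1 * (l%:R * (2 * h)) =
    2 * l%:R * alpha^-1 * (h * h ^+ l.-1) by ring.
rewrite -exprS prednK// -[leRHS]mulrA ler_wpM2l//; first by rewrite !mulr_ge0.
by rewrite [leRHS]mulrC ler_pdivlMr// mulrC; exact: am_vol am K.
Qed.

(** Discrete integration by parts: a conservative flux tested with [w] sees
    only the jumps of [w]. *)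
Lemma sum_antisym (G : cell m -> cell m -> R) w :
  (forall K L, nb K L -> G K L = - G L K) ->
  \sum_K \sum_(L | nb K L) G K L * w K =
  2^-1 * \sum_K \sum_(L | nb K L) G K L * (w K - w L).
Proof.
move=> aG; set S := LHS.
have E : \sum_K \sum_(L | nb K L) G K L * w L = - S.
  rewrite /S -sumrN (exchange_big_dep predT)//=; apply: eq_bigr => K _.
  rewrite -sumrN (eq_bigl (fun L => nb K L)) => [|L]; last by rewrite nbC.
  by apply: eq_bigr => L KL; rewrite (aG L K) 1?nbC// mulNr.
suff -> : \sum_K \sum_(L | nb K L) G K L * (w K - w L) = S - - S by field.
rewrite -E /S -sumrB; apply: eq_bigr => K _.
by rewrite -sumrB; apply: eq_bigr => L _; rewrite mulrBr.
Qed.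

(** The weights are chosen so that the square of the jump carries the
    transmissivity and the rest is summable by [diamond_sum_le]. *)
Lemma young_edge K L (G c x : R) : nb K L -> `|G| <= smeas (face K (inl L)) * c ->
  `|G * x| <= 2^-1 * (c ^+ 2 * (smeas (face K (inl L)) * dist K L) +
                      transm K L * x ^+ 2).
Proof.
move=> KL Gc; have d0 := dist_gt0 KL; rewrite /transm.
set s := smeas _ in Gc *; set d := dist K L in d0 *.
have s0 : 0 <= s by exact: smeas_ge0.
rewrite normrM; apply: (@le_trans _ _ (s * c * `|x|)); first by rewrite ler_wpM2r.
have : 0 <= s / d * (c * d - `|x|) ^+ 2.
  by rewrite mulr_ge0// ?sqr_ge0// divr_ge0// ltW.
have -> : s / d * (c * d - `|x|) ^+ 2 =
    c ^+ 2 * (s * d) - 2 * (s * c * `|x|) + s / d * `|x| ^+ 2.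
  by field; rewrite gt_eqF.
rewrite real_normK ?num_real// => h1; lra.
Qed.

Lemma xint_diff_le (v w : cell m -> R) :
  (xint Omega (fun x =>
     ((`|piecewise v x - piecewise w x| ^+ 2)%R)%:E) <=
   (\sum_K vmeas (vol K) * (v K - w K) ^+ 2)%:E)%E.
Proof.
apply: (@le_trans _ _ (\sum_K ((v K - w K) ^+ 2)%:E * vleb (vol K))%E).
  apply: (@le_integral_step _ _ _ _ _ set0 _ _ _ (fun K => @vec R l @^-1` vol K)).
  - exact: measurable0.
  - exact: measure0.
  - by move=> K; exact: sqr_ge0.
  - by move=> K; exact: vmeasurable_vol.
  - by move=> t _; rewrite lee_fin sqr_ge0.
  - move=> t _ _; rewrite lee_fin.
    have t0 K : 0 <= (v K - w K) ^+ 2 * \1_(@vec R l @^-1` vol K) t.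
      by rewrite mulr_ge0// sqr_ge0.
    have [[K Kt]|nK] := pselect (exists K, vol K (vec t)).
      rewrite (piecewise_in v Kt) (piecewise_in w Kt) (bigD1 K)//= indicE mem_set//.
      by rewrite mulr1 real_normK ?num_real// lerDl sumr_ge0.
    rewrite !piecewise_out => [|K Kt|K Kt].
    + by rewrite subrr normr0 expr0n/= sumr_ge0.
    + by apply: nK; exists K.
    + by apply: nK; exists K.
rewrite -sumEFin; apply: lee_sum => K _.
rewrite vlebE; [|exact: vmeasurable_vol|exact: bounded_vol].
by rewrite -EFinM mulrC.
Qed.

(** * Energy estimate for the scheme *)

Section scheme.
Context (umax uc M dt : R) (f : R -> 'rV[R]_l) (phi : R -> R)
  (F : cell m -> cell m + bedge m -> R -> R -> R) (u0 : 'rV[R]_l -> R)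
  (u : nat -> cell m -> R).
Hypotheses (pd : problem_data umax uc f phi)
  (nf : numerical_flux umax M f F) (dt0 : 0 < dt)
  (ss : scheme_solution umax dt phi F u0 u).

Let c := `|M| * (umax + umax).
Let p n K := phi (u n K).

Lemma scheme_range n K : u n K \in `[0, umax].
Proof. by rewrite in_itv/=; exact: ss_range ss n K. Qed.

(** Consistency and f(0) = 0 give F(0, 0) = 0; the Lipschitz bound does the
    rest. *)
Lemma flux_le K L a b : nb K L -> a \in `[0, umax] -> b \in `[0, umax] ->
  `|F K (inl L) a b| <= smeas (face K (inl L)) * c.
Proof.
move=> KL aI bI; have e : is_edge K (inl L) by [].
have um := ltW (pd_umax pd).
have I0 : 0 \in `[0, umax] by rewrite in_itv/= lexx.
have F0 : F K (inl L) 0 0 = 0.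
  rewrite (nf_consistent nf e I0) (pd_f0 pd) -[X in dot X](scale0r (0 : 'rV[R]_l)).
  by rewrite dotZl mul0r mulr0.
have := nf_regular nf e aI bI I0 I0; rewrite F0 !subr0 => /le_trans; apply.
move: aI bI; rewrite !in_itv/= => /andP[a0 a1] /andP[b0 b1].
rewrite -mulrA ler_wpM2l ?smeas_ge0// /c.
apply: (@le_trans _ _ (`|M| * (`|a| + `|b|))).
  by rewrite ler_wpM2r// ?addr_ge0// ler_norm.
by rewrite ler_wpM2l// !ger0_norm// lerD.
Qed.

(** The weak form of the scheme, with test function [w]. *)
Lemma scheme_test n w :
  \sum_K vmeas (vol K) * (u n.+1 K - u n K) * w K =
  dt * (2^-1 * \sum_K \sum_(L | nb K L)
    (transm K L * (p n.+1 L - p n.+1 K) - F K (inl L) (u n.+1 K) (u n.+1 L)) *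
    (w K - w L)).
Proof.
rewrite -sum_antisym; last first.
  move=> K L KL.
  rewrite (nf_conservative nf KL (scheme_range _ _) (scheme_range _ _)) transmC.
  by ring.
rewrite mulr_sumr; apply: eq_bigr => K _; rewrite -mulr_suml sumrB.
have := ss_step ss n K; rewrite -/(p n.+1 K) => /eqP; rewrite subr_eq0 => /eqP <-.
by rewrite addrK; field; rewrite gt_eqF.
Qed.

(** For [w = p n.+1] the diffusion term is minus half the energy, and
    Young's inequality for the flux gives half of that back. *)
Lemma energy_step n :
  \sum_K vmeas (vol K) * (u n.+1 K - u n K) * p n.+1 K <=
  dt * (4^-1 * c ^+ 2 * diamond_sum - 4^-1 * edge_energy (p n.+1)).
Proof.
rewrite scheme_test ler_pM2l//.
have -> : 4^-1 * c ^+ 2 * diamond_sum - 4^-1 * edge_energy (p n.+1) =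
  2^-1 * (2^-1 * (c ^+ 2 * diamond_sum) - 2^-1 * edge_energy (p n.+1)) by field.
rewrite ler_pM2l ?invr_gt0// /edge_energy /diamond_sum !mulr_sumr -sumrB.
apply: ler_sum => K _; rewrite !mulr_sumr -sumrB; apply: ler_sum => L KL.
have := young_edge (p n.+1 K - p n.+1 L) KL
  (flux_le KL (scheme_range n.+1 K) (scheme_range n.+1 L)).
set G := F _ _ _ _; set x := p n.+1 K - p n.+1 L.
rewrite ler_norml => /andP[h1 _].
have -> : p n.+1 L - p n.+1 K = - x by rewrite /x opprB.
rewrite sqrrN; set T := transm K L in h1 *; set Y := smeas _ * _ in h1 *.
by lra.
Qed.

Lemma test_le n w :
  \sum_K vmeas (vol K) * (u n.+1 K - u n K) * w K <=
  dt * (edge_energy (p n.+1) + edge_energy w + c ^+ 2 * diamond_sum).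
Proof.
rewrite scheme_test ler_pM2l//.
apply: (@le_trans _ _ (2^-1 * (2^-1 * edge_energy (p n.+1) + edge_energy w +
    2^-1 * (c ^+ 2 * diamond_sum)))).
  rewrite ler_pM2l ?invr_gt0// /edge_energy /diamond_sum !mulr_sumr -!big_split/=.
  apply: ler_sum => K _; rewrite !mulr_sumr -!big_split/=; apply: ler_sum => L KL.
  have := young_edge (w K - w L) KL
    (flux_le KL (scheme_range n.+1 K) (scheme_range n.+1 L)).
  have T0 := transm_ge0 KL.
  set G := F _ _ _ _; set x := w K - w L; set y := p n.+1 L - _.
  rewrite ler_norml => /andP[h1 _].
  have -> : w L - w K = - x by rewrite /x opprB.
  rewrite sqrrN; set T := transm K L in T0 h1 *; set Y := smeas _ * _ in h1 *.
  have : 0 <= T * (y - x) ^+ 2 by rewrite mulr_ge0 ?sqr_ge0.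
  by move=> h2; lra.
have := edge_energy_ge0 (p n.+1); have := edge_energy_ge0 w.
have : 0 <= c ^+ 2 * diamond_sum by rewrite mulr_ge0 ?sqr_ge0 ?diamond_sum_ge0.
by move=> h1 h2 h3; lra.
Qed.

Lemma phi0 : phi 0 = 0.
Proof. by apply: (pd_phi0 pd); rewrite in_itv/= lexx; case/andP: (pd_uc pd). Qed.

Lemma phi_ge0 a : a \in `[0, umax] -> 0 <= phi a.
Proof.
move=> aI; rewrite -phi0; apply: (pd_phi_nondecr pd) => //.
  by rewrite in_itv/= lexx ltW// (pd_umax pd).
by move: aI; rewrite in_itv/= => /andP[].
Qed.

Lemma phi_le a : a \in `[0, umax] -> phi a <= phi umax.
Proof.
move=> aI; apply: (pd_phi_nondecr pd) => //.
  by rewrite in_itv/= lexx ltW// (pd_umax pd).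
by move: aI; rewrite in_itv/= => /andP[].
Qed.

(** The integral of phi from 0 is convex because phi is nondecreasing; phi
    is extended by constants outside [0, umax] to make it monotone on the
    whole line. *)
Lemma phi_primitive : exists2 Phi : R -> R,
  {in `[0, umax] &, forall a b, Phi a - Phi b <= (a - b) * phi a} &
  {in `[0, umax], forall a, 0 <= Phi a <= umax * phi umax}.
Proof.
pose g (t : R) := phi (Num.max 0 (Num.min umax t)).
have um := ltW (pd_umax pd).
have cl t : Num.max 0 (Num.min umax t) \in `[0, umax].
  by rewrite in_itv/= le_max lexx/= ge_max um ge_min lexx.
have gE t : t \in `[0, umax] -> g t = phi t.
  by rewrite in_itv/= /g => /andP[t0 t1]; rewrite min_r// max_r.
have g_nd : {homo g : x y / x <= y}.
  move=> x y xy; apply: (pd_phi_nondecr pd) => //.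
  by rewrite ge_max !le_max lexx/= le_min !ge_min lexx xy !orbT.
have mg (D : set R) : measurable D -> measurable_fun D g.
  by move=> mD; apply: nondecreasing_measurable.
have ig (a b : R) : lebesgue_measure.-integrable `]a, b] (EFin \o g).
  apply: measurable_bounded_integrable => //.
  - by rewrite [X in (X < _)%E](lebesgue_measure_oc a b) ltry.
  - exact: mg.
  - exists (phi umax); split; first exact: num_real.
    move=> x hx t _ /=; apply: le_trans (ltW hx).
    by rewrite ger0_norm ?phi_ge0 ?phi_le.
have mu_itv (a b : R) : a <= b -> fine (lebesgue_measure `]a, b]%classic) = b - a.
  by move=> ab; rewrite [X in fine X](lebesgue_measure_oc a b)/= max_r// subr_ge0.
have icst (a b r : R) : lebesgue_measure.-integrable `]a, b] (EFin \o cst r).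
  apply: measurable_bounded_integrable => //.
  - by rewrite [X in (X < _)%E](lebesgue_measure_oc a b) ltry.
  - exists `|r|; split; first exact: num_real.
    by move=> x hx t _ /=; exact: ltW.
pose Phi a : R := (\int[lebesgue_measure]_(t in `]0%R, a]) g t)%R.
have PhiB a b : 0 <= b -> b <= a -> Phi a - Phi b =
    (\int[lebesgue_measure]_(t in `]b, a]) g t)%R.
  by move=> b0 ba; rewrite /Phi Rintegral_itvB//= bnd_simp.
have key : {in `[0, umax] &, forall a b, Phi a - Phi b <= (a - b) * phi a}.
  move=> a b; rewrite !in_itv/= => /andP[a0 a1] /andP[b0 b1].
  have ga : phi a = g a by rewrite gE// in_itv/= a0.
  have [ba|/ltW ab] := leP b a.
    rewrite PhiB//; apply: (@le_trans _ _
      (\int[lebesgue_measure]_(t in `]b, a]) cst (phi a) t)%R).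
      apply: le_Rintegral => // x /=; rewrite in_itv/= => /andP[_ xa].
      by rewrite ga; exact: g_nd.
    by rewrite Rintegral_cst// mu_itv// mulrC.
  rewrite -opprB PhiB// -[a - b]opprB mulNr lerN2.
  apply: (@le_trans _ _ (\int[lebesgue_measure]_(t in `]a, b]) cst (phi a) t)%R).
    by rewrite Rintegral_cst// mu_itv// mulrC.
  apply: le_Rintegral => // x /=; rewrite in_itv/= => /andP[/ltW xa _].
  by rewrite ga; exact: g_nd.
exists Phi => // a aI; apply/andP; split.
  by apply: Rintegral_ge0 => x _; exact: phi_ge0.
have I0 : 0 \in `[0, umax] by rewrite in_itv/= lexx.
have := key a 0 aI I0; rewrite {2}/Phi set_itv_ge ?bnd_simp// Rintegral_set0 !subr0.
move=> /le_trans; apply; have := aI; rewrite in_itv/= => /andP[a0 a1].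
by rewrite ler_pM// ?phi_ge0 ?phi_le.
Qed.

(** By convexity of the primitive Phi, testing with phi(u^{n+1}) dominates
    the increment of the sum of m(K) Phi(u_K), so the time sum telescopes. *)
Lemma energy_sum (N : nat) :
  \sum_(n < N) dt * edge_energy (p n.+1) <=
  4 * (vmeas Omega * (umax * phi umax)) + N%:R * dt * (c ^+ 2 * diamond_sum).
Proof.
have [Phi kPhi bPhi] := phi_primitive.
pose S n := \sum_K vmeas (vol K) * Phi (u n K).
have step n : dt * edge_energy (p n.+1) <=
    4 * (S n - S n.+1) + dt * (c ^+ 2 * diamond_sum).
  have : S n.+1 - S n <= dt * (4^-1 * c ^+ 2 * diamond_sum -
      4^-1 * edge_energy (p n.+1)).
    apply: le_trans (energy_step n); rewrite /S -sumrB; apply: ler_sum => K _.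
    rewrite -mulrBr -mulrA ler_wpM2l ?vmeas_ge0//.
    by apply: kPhi; exact: scheme_range.
  by move=> h1; lra.
have : \sum_(n < N) dt * edge_energy (p n.+1) <=
    4 * (S 0%N - S N) + N%:R * dt * (c ^+ 2 * diamond_sum).
  elim: N => [|N IH]; first by rewrite big_ord0 subrr mulr0 !mul0r addr0.
  rewrite big_ord_recr/=; have := step N; rewrite -natr1 => h1.
  by move: IH h1; set A := \sum_(_ < _) _; set D := c ^+ 2 * _; move=> h1 h2; lra.
move=> /le_trans; apply; rewrite lerD2r ler_pM2l//.
have SN : 0 <= S N.
  apply: sumr_ge0 => K _; rewrite mulr_ge0 ?vmeas_ge0//.
  by have /andP[] := bPhi _ (scheme_range N K).
apply: (@le_trans _ _ (S 0%N)); first by rewrite gerBl.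
apply: (@le_trans _ _ (\sum_(K : cell m) vmeas (vol K) * (umax * phi umax))).
  apply: ler_sum => K _; rewrite ler_wpM2l ?vmeas_ge0//.
  by have /andP[] := bPhi _ (scheme_range 0 K).
rewrite -mulr_suml ler_wpM2r ?vmeas_vol_le//.
rewrite mulr_ge0//; first exact: ltW (pd_umax pd).
by apply: phi_ge0; rewrite in_itv/= lexx ltW// (pd_umax pd).
Qed.

(** Monotonicity and the Lipschitz bound give
    (phi a - phi b)^2 <= k (a - b) (phi a - phi b).  The increment a - b is the
    sum of the increments of the scheme between the levels n0 and n1, each of
    which is tested with the fixed function phi(u^{n1}) - phi(u^{n0}). *)
Lemma jump_le (k : R) (n0 n1 : nat) :
  {in `[0, umax] &, forall a b, `|phi a - phi b| <= k * `|a - b|} ->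
  (n0 <= n1)%N ->
  \sum_K vmeas (vol K) * (p n1 K - p n0 K) ^+ 2 <=
  `|k| * \sum_(n0 <= n < n1) dt * (edge_energy (p n.+1) +
     2 * edge_energy (p n1) + 2 * edge_energy (p n0) + c ^+ 2 * diamond_sum).
Proof.
move=> lk n01; pose w K := p n1 K - p n0 K.
apply: (@le_trans _ _ (`|k| * \sum_K vmeas (vol K) * (u n1 K - u n0 K) * w K)).
  rewrite mulr_sumr; apply: ler_sum => K _.
  have -> : `|k| * (vmeas (vol K) * (u n1 K - u n0 K) * w K) =
    vmeas (vol K) * (`|k| * ((u n1 K - u n0 K) * w K)) by ring.
  rewrite ler_wpM2l ?vmeas_ge0//.
  have I1 := scheme_range n1 K; have I0 := scheme_range n0 K.
  have := lk _ _ I1 I0; rewrite -/(p n1 K) -/(p n0 K) -/(w K) => h1.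
  have -> : (u n1 K - u n0 K) * w K = `|u n1 K - u n0 K| * `|w K|.
    rewrite -normrM ger0_norm//.
    have [le|/ltW le] := leP (u n0 K) (u n1 K).
      by rewrite mulr_ge0 ?subr_ge0//; apply: (pd_phi_nondecr pd).
    by rewrite mulr_le0 ?subr_le0//; apply: (pd_phi_nondecr pd).
  rewrite -real_normK ?num_real// expr2 mulrA ler_wpM2r//.
  by apply: le_trans h1 _; rewrite ler_wpM2r// ler_norm.
rewrite ler_wpM2l//.
have -> : \sum_K vmeas (vol K) * (u n1 K - u n0 K) * w K =
    \sum_(n0 <= n < n1) \sum_K vmeas (vol K) * (u n.+1 K - u n K) * w K.
  rewrite exchange_big/=; apply: eq_bigr => K _.
  by rewrite -mulr_suml -mulr_sumr telescope_sumr.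
apply: ler_sum => n _; apply: le_trans (test_le n w) _.
rewrite ler_pM2l//; have := edge_energyB (p n1) (p n0); rewrite -/w.
by move=> h1; lra.
Qed.

(** * Translates in time *)

(** If T <= dt, only one time level occurs and there is no jump.
    Otherwise let N be the index of T, so that N dt <= 2 T.  The bound of
    [jump_le] is a step function of t, carried by the intervals [I n] where
    the level n dt is crossed, and by their intersections with the intervals
    [J 0 j] and [J tau j] where t, respectively t + tau, has index j + 1.  The
    measure of [I n] is tau; the measures of the intersections are summed over
    n first, for fixed j, and again yield at most tau.  What remains is the
    energy of [energy_sum]. *)
Lemma time_shift_le (k T tau : R) :
  {in `[0, umax] &, forall a b, `|phi a - phi b| <= k * `|a - b|} ->
  0 < tau -> tau < T ->
  (\int[@lebesgue_measure R]_(t in `[0%R, (T - tau)%R])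
     xint Omega (fun x =>
       (`|phi (approx_solution dt u (t + tau) x)
          - phi (approx_solution dt u t x)| ^+ 2)%R%:E)
   <= (`|k| * (20 * (vmeas Omega * (umax * phi umax)) +
        12 * T * (c ^+ 2 * diamond_sum)) * tau)%:E)%E.
Proof.
move=> lk tau0 tauT; pose V := vmeas Omega * (umax * phi umax).
pose D := c ^+ 2 * diamond_sum.
have D0 : 0 <= D by rewrite mulr_ge0 ?sqr_ge0// diamond_sum_ge0.
have V0 : 0 <= V.
  rewrite mulr_ge0 ?vmeas_ge0// mulr_ge0//; first exact: ltW (pd_umax pd).
  by apply: phi_ge0; rewrite in_itv/= lexx ltW// (pd_umax pd).
have T0 : 0 < T by exact: lt_trans tauT.
pose A n := edge_energy (p n).
have A0 n : 0 <= A n by exact: edge_energy_ge0.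
pose N := time_index dt T.
have f0 t : (0 <= xint Omega (fun x =>
    (`|phi (approx_solution dt u (t + tau) x)
       - phi (approx_solution dt u t x)| ^+ 2)%R%:E))%E.
  by apply: integral_ge0 => x _; rewrite lee_fin sqr_ge0.
pose S t : R := `|k| * \sum_(time_index dt t <= n < time_index dt (t + tau))
   dt * (A n.+1 + 2 * A (time_index dt (t + tau)) + 2 * A (time_index dt t) + D).
have fS t : 0 < t -> (xint Omega (fun x =>
    (`|phi (approx_solution dt u (t + tau) x)
       - phi (approx_solution dt u t x)| ^+ 2)%R%:E) <= (S t)%:E)%E.
  move=> t0; apply: le_trans (_ : _ <= (\sum_K vmeas (vol K) *
     (p (time_index dt (t + tau)) K - p (time_index dt t) K) ^+ 2)%:E)%E _.
    apply: le_trans (xint_diff_le _ _); rewrite /xint.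
    rewrite le_eqVlt; apply/orP; left; apply/eqP; congr integral; apply/funext => x.
    by rewrite /approx_solution !(piecewise_comp _ _ phi0).
  rewrite lee_fin; apply: jump_le => //.
  rewrite time_index_le//.
  apply: (@le_trans _ _ (t + tau)); first by rewrite lerDl ltW.
  by rewrite -time_index_le// addr_gt0.
have pos t : (`[0%R, (T - tau)%R]%classic : set R) t -> ~ [set 0] t ->
    0 < t /\ t + tau <= T.
  rewrite /= in_itv/= => /andP[t0 t1] /eqP tn; split; last by rewrite -lerBrDr.
  by rewrite lt_neqAle eq_sym tn.
have [Tdt|dtT] := leP T dt.
  apply: (@le_trans _ _ (\int[@lebesgue_measure R]_t 0)%E); last first.
    rewrite integral0 lee_fin -/V -/D; apply: mulr_ge0; last exact: ltW.
    apply: mulr_ge0 => //; apply: addr_ge0; first exact: mulr_ge0.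
    by apply: mulr_ge0 => //; apply: mulr_ge0 => //; exact: ltW.
  apply: (@le_integral_negl _ _ _ (@lebesgue_measure R) _ [set 0]) => //.
  - exact: lebesgue_measure_set1.
  - move=> t tI tn; have [t0 tT] := pos t tI tn.
    apply: le_trans (fS t t0) _; rewrite lee_fin /S big_geq ?mulr0//.
    apply: (@leq_trans 1).
      by rewrite time_index_le ?addr_gt0// mul1r (le_trans tT).
    by rewrite ltnNge time_index_le// mul0r -ltNge.
(* (N - 1) dt < T and dt < T. *)
have NT : N%:R * dt <= 2 * T.
  have N0 : (0 < N)%N by rewrite ltnNge time_index_le// mul0r -ltNge.
  have : ~~ (N <= N.-1)%N by rewrite -ltnNge prednK.
  rewrite {1}/N time_index_le// -ltNge => h1.
  by rewrite -[N in N%:R](prednK N0) -natr1; lra.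
pose I (n : nat) : set R := `](n%:R * dt - tau), (n%:R * dt)]%classic.
pose J (a : R) (j : nat) : set R :=
  `](j%:R * dt - a), (j%:R * dt - a + dt)]%classic.
pose ix : finType := ('I_N + ('I_N * 'I_N + 'I_N * 'I_N))%type.
pose cf (i : ix) : R := match i with
  | inl n => `|k| * dt * (A n.+1 + D)
  | inr (inl q) => `|k| * dt * (2 * A q.2.+1)
  | inr (inr q) => `|k| * dt * (2 * A q.2.+1) end.
pose st (i : ix) : set (measurableTypeR R) := match i with
  | inl n => I n
  | inr (inl q) => I q.1 `&` J 0 q.2
  | inr (inr q) => I q.1 `&` J tau q.2 end.
pose ov (i : ix) : R := match i with
  | inl n => tau
  | inr (inl q) => clamp tau (q.1%:R * dt - (q.2%:R * dt - 0))
                   - clamp tau (q.1%:R * dt - (q.2%:R * dt - 0) - dt)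
  | inr (inr q) => clamp tau (q.1%:R * dt - (q.2%:R * dt - tau))
                   - clamp tau (q.1%:R * dt - (q.2%:R * dt - tau) - dt) end.
have kdt : 0 <= `|k| * dt by rewrite mulr_ge0// ltW.
have cf0 i : 0 <= cf i.
  case: i => [n|[q|q]]; rewrite /cf; apply: mulr_ge0 => //.
  - exact: addr_ge0.
  - exact: mulr_ge0.
  - exact: mulr_ge0.
apply: (@le_trans _ _ (\sum_i (cf i)%:E * lebesgue_measure (st i))%E).
  apply: (@le_integral_step _ _ _ (@lebesgue_measure R) _ [set 0]) => //.
  - exact: lebesgue_measure_set1.
  - case=> [n|[q|q]]; rewrite /st; first exact: measurable_itv.
      by apply: measurableI; exact: measurable_itv.
    by apply: measurableI; exact: measurable_itv.
  - move=> t tI tn; have [t0 tT] := pos t tI tn.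
    apply: le_trans (fS t t0) _; rewrite lee_fin /S.
    have nN : (time_index dt (t + tau) <= N)%N.
      rewrite time_index_le ?addr_gt0//; apply: le_trans tT _.
      by rewrite -time_index_le.
    have n0N : (time_index dt (t + 0) <= N)%N.
      rewrite addr0 time_index_le//.
      apply: (@le_trans _ _ (t + tau)); first by rewrite lerDl ltW.
      by rewrite -time_index_le// addr_gt0.
    have t00 : 0 < t + 0 by rewrite addr0.
    have := time_index_indicator (X := A) dt0 A0 t00 n0N; rewrite addr0.
    have := time_index_indicator (X := A) dt0 A0 (addr_gt0 t0 tau0) nN.
    set n1 := time_index dt (t + tau); set n0 := time_index dt t => hn1 hn0.
    rewrite (sum_indicator_time
      (fun n => dt * (A n.+1 + 2 * A n1 + 2 * A n0 + D)) dt0 t0 tau0 nN).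
    rewrite !big_sumType/=.
    rewrite -(pair_bigA _ (fun n j : 'I_N =>
      `|k| * dt * (2 * A j.+1) * \1_(I n `&` J 0 j) t))/=.
    rewrite -(pair_bigA _ (fun n j : 'I_N =>
      `|k| * dt * (2 * A j.+1) * \1_(I n `&` J tau j) t))/=.
    rewrite -!big_split mulr_sumr; apply: ler_sum => n _ /=.
    rewrite -/(I n); set s := \1_(I n) t.
    have s0 : 0 <= s by [].
    have -> : `|k| * (dt * (A n.+1 + 2 * A n1 + 2 * A n0 + D) * s) =
      `|k| * dt * (A n.+1 + D) * s +
      (`|k| * dt * 2 * s * A n0 + `|k| * dt * 2 * s * A n1) by ring.
    rewrite lerD2l; apply: lerD.
      apply: (@le_trans _ _ (`|k| * dt * 2 * s *
          \sum_(j < N) A j.+1 * \1_(J 0 j) t)).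
        by apply: ler_wpM2l; [rewrite 2?mulr_ge0|exact: hn0].
      rewrite mulr_sumr; apply: ler_sum => j _; rewrite indicI/=.
      by rewrite le_eqVlt; apply/orP; left; apply/eqP; rewrite -/s; ring.
    apply: (@le_trans _ _ (`|k| * dt * 2 * s *
        \sum_(j < N) A j.+1 * \1_(J tau j) t)).
      by apply: ler_wpM2l; [rewrite 2?mulr_ge0|exact: hn1].
    rewrite mulr_sumr; apply: ler_sum => j _; rewrite indicI/=.
    by rewrite le_eqVlt; apply/orP; left; apply/eqP; rewrite -/s; ring.
have mu_ov i : (lebesgue_measure (st i) <= (ov i)%:E)%E.
  case: i => [n|[q|q]]; rewrite /st /ov; [|exact: overlap_le|exact: overlap_le].
  by rewrite lebesgue_measure_oc opprB addrC subrK max_r// ltW.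
apply: (@le_trans _ _ (\sum_i cf i * ov i)%:E).
  rewrite -sumEFin; apply: lee_sum => i _; rewrite EFinM.
  by apply: lee_wpmul2l => //; rewrite lee_fin.
rewrite lee_fin !big_sumType/=.
pose E := \sum_(n < N) dt * A n.+1.
have ovs a : \sum_(q : 'I_N * 'I_N) `|k| * dt * (2 * A q.2.+1) *
    (clamp tau (q.1%:R * dt - (q.2%:R * dt - a))
     - clamp tau (q.1%:R * dt - (q.2%:R * dt - a) - dt)) <= 2 * `|k| * tau * E.
  rewrite -(pair_bigA _ (fun n j : 'I_N => `|k| * dt * (2 * A j.+1) *
    (clamp tau (n%:R * dt - (j%:R * dt - a))
     - clamp tau (n%:R * dt - (j%:R * dt - a) - dt))))/= exchange_big/=.
  rewrite /E mulr_sumr; apply: ler_sum => j _; rewrite -mulr_sumr.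
  apply: (@le_trans _ _ (`|k| * dt * (2 * A j.+1) * tau)).
    by apply: ler_wpM2l; [apply: mulr_ge0 => //; exact: mulr_ge0|exact: clamp_sum].
  by rewrite le_eqVlt; apply/orP; left; apply/eqP; ring.
have first : \sum_(n < N) `|k| * dt * (A n.+1 + D) * tau =
    `|k| * tau * (E + N%:R * dt * D).
  rewrite -mulr_suml -mulr_sumr big_split/= sumr_const card_ord /E -mulr_sumr.
  by rewrite -[D *+ N]mulr_natl; ring.
have EV : E <= 4 * V + N%:R * dt * D by exact: energy_sum.
have := ovs 0; have := ovs tau; rewrite first -/V -/D => h1 h2.
have kt : 0 <= `|k| * tau by rewrite mulr_ge0// ltW.
apply: (@le_trans _ _ (`|k| * tau * (5 * E + N%:R * dt * D))); first by lra.
rewrite [leRHS]mulrAC.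
rewrite ler_wpM2l//.
have : N%:R * dt * D <= 2 * T * D by rewrite ler_wpM2r.
set ND := N%:R * dt * D in EV *; set TD := T * D.
by rewrite -!mulrA -/TD => h3; lra.
Qed.

(** * Integration in time of the space translates *)

Lemma discrete_H_sqr w : discrete_H w ^+ 2 = l%:R * edge_energy w.
Proof. by rewrite sqr_sqrtr// mulr_ge0// edge_energy_ge0. Qed.

(** The integrand in t depends on t through its time index only, so the
    estimate of [xint_shift_le] at each index integrates to the square of
    [phi_seminorm].  If no segment of direction eta fits in Omega the left
    side vanishes; otherwise |eta| is at most the diameter of Omega, which
    makes the constant independent of eta. *)
Lemma space_shift_le (r T : R) eta : 0 <= r -> Omega `<=` cube 0 r -> 0 < T ->
  (\int[@lebesgue_measure R]_(t in `[0%R, T])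
     xint (shifted Omega eta) (fun x =>
       (`|phi (approx_solution dt u t (x + eta))
          - phi (approx_solution dt u t x)| ^+ 2)%R%:E)
   <= (4 ^+ l / alpha * (2 * r + 2 * (l%:R * (r + r))) * (l%:R * 2) * l%:R *
       phi_seminorm T dt phi u ^+ 2 * enorm eta)%R%:E)%E.
Proof.
move=> r0 Or T0; set C0 := 4 ^+ l / alpha * _ * _ * _.
have B0 : 0 <= 4 ^+ l / alpha by rewrite divr_ge0// ?exprn_ge0// ltW.
have h0 := mesh_size_ge0; have hr := mesh_size_le r0 Or.
have C00 : 0 <= C0.
  apply: mulr_ge0 => //; apply: mulr_ge0; last by rewrite mulr_ge0.
  by apply: mulr_ge0 => //; rewrite addr_ge0 ?mulr_ge0 ?addr_ge0.
have e0 : 0 <= enorm eta by exact: sqrtr_ge0.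
pose d2 n : R := discrete_H (p n) ^+ 2.
have d20 n : 0 <= d2 n by exact: sqr_ge0.
pose X n : \bar R := xint (shifted Omega eta) (fun x =>
  ((`|piecewise (p n) (x + eta) - piecewise (p n) x| ^+ 2)%R)%:E).
have XE n : (X n <= (C0 * enorm eta * d2 n)%:E)%E.
  have [[x [Ox seg]]|nx] := pselect (exists x, shifted Omega eta x); last first.
    rewrite /X /xint (_ : shifted Omega eta = set0) ?preimage_set0 ?integral_set0.
      by rewrite lee_fin; apply: mulr_ge0 => //; exact: mulr_ge0.
    by rewrite -subset0 => x sx; apply: nx; exists x.
  have er : `|eta| <= 2 * r.
    have Oxe : Omega (x + eta).
      by have := seg 1; rewrite scale1r; apply; rewrite ler01 lexx.
    have := Or _ Ox; have := Or _ Oxe; rewrite /cube/= !subr0 => h1 h2.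
    rewrite -[eta](addKr x) addrC; apply: le_trans (ler_normB _ _) _.
    by rewrite mulr_natl mulr2n lerD.
  apply: le_trans (xint_shift_le _ _) _; rewrite lee_fin /d2 discrete_H_sqr.
  rewrite -/(edge_energy (p n)); have E0 := edge_energy_ge0 (p n).
  have -> : C0 * enorm eta * (l%:R * edge_energy (p n)) =
    4 ^+ l / alpha * (2 * r + 2 * (l%:R * (r + r))) * (l%:R * 2) *
    (l%:R * enorm eta) * (l%:R * edge_energy (p n)) by rewrite /C0; ring.
  have l1 : 1 <= l%:R :> R by rewrite ler1n.
  have P1 : 0 <= 4 ^+ l / alpha * (`|eta| + 2 * h) * (l%:R * 2).
    apply: mulr_ge0; last exact: mulr_ge0.
    by apply: mulr_ge0 => //; apply: addr_ge0 => //; exact: mulr_ge0.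
  have P2 : 0 <= l%:R * `|eta| by exact: mulr_ge0.
  apply: ler_pM => //; [exact: mulr_ge0| |by rewrite ler_peMl].
  apply: ler_pM => //; last by apply: ler_wpM2l => //; exact: norm_le_enorm.
  apply: ler_wpM2r; first exact: mulr_ge0.
  by apply: ler_wpM2l => //; apply: lerD => //; exact: ler_wpM2l.
have mX : measurable_fun `[0%R, T]%classic
    (fun t : measurableTypeR R => X (time_index dt t)).
  by apply: measurable_funTS; exact: measurable_time_index.
have md : measurable_fun `[0%R, T]%classic
    (fun t : measurableTypeR R => (d2 (time_index dt t))%:E).
  by apply: measurable_funTS; exact: (measurable_time_index (fun n => (d2 n)%:E)).
have X0 n : (0 <= X n)%E by apply: integral_ge0 => x _; rewrite lee_fin sqr_ge0.
have id : lebesgue_measure.-integrable `[0%R, T]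
    (EFin \o (fun t => d2 (time_index dt t))).
  apply: measurable_bounded_integrable => //.
  - have := lebesgue_measure_itv `[0%R, T]; rewrite /= => ->.
    by case: ifP => // _; rewrite -EFinB ltry.
  - exact/measurable_EFinP.
  - pose N := time_index dt T.
    exists (\sum_(n < N.+1) d2 n); split; first exact: num_real.
    move=> x hx t /=; rewrite in_itv/= => /andP[t0 tT].
    apply: le_trans (ltW hx); rewrite ger0_norm//.
    have tN : (time_index dt t < N.+1)%N.
      rewrite ltnS; move: t0; rewrite le_eqVlt => /predU1P[<-|t0].
        by rewrite /time_index mul0r ceil0.
      by rewrite time_index_le//; apply: le_trans tT _; rewrite -time_index_le.
    by rewrite (bigD1 (Ordinal tN))//= lerDl sumr_ge0.
apply: (@le_trans _ _ (\int[@lebesgue_measure R]_(t in `[0%R, T])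
    ((C0 * enorm eta)%:E * (d2 (time_index dt t))%:E))%E).
  have -> : (\int[@lebesgue_measure R]_(t in `[0%R, T])
     xint (shifted Omega eta) (fun x =>
       (`|phi (approx_solution dt u t (x + eta))
          - phi (approx_solution dt u t x)| ^+ 2)%R%:E) =
     \int[@lebesgue_measure R]_(t in `[0%R, T]) X (time_index dt t))%E.
    apply: eq_integral => t _; rewrite /X /xint; apply: eq_integral => x _.
    by rewrite /approx_solution !(piecewise_comp _ _ phi0).
  by apply: ge0_le_integral => //; exact: measurable_funeM.
rewrite ge0_integralZl_EFin//; [|by move=> t _; rewrite lee_fin|exact: mulr_ge0].
have -> : (\int[@lebesgue_measure R]_(t in `[0%R, T]) (d2 (time_index dt t))%:E)%E =
    (phi_seminorm T dt phi u ^+ 2)%:E.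
  rewrite sqr_sqrtr; last by apply: Rintegral_ge0 => t _; exact: sqr_ge0.
  by rewrite /Rintegral fineK//; exact: integrable_fin_num.
by rewrite -EFinM lee_fin le_eqVlt; apply/orP; left; apply/eqP; ring.
Qed.

End scheme.

End mesh_geometry.

(** * The two translation estimates *)

Theorem lemma4p6 (R : realType) (l : nat) (Omega : set 'rV[R]_l) (T alpha : R) :
  (0 < l)%N -> open Omega -> bounded_set Omega -> lipschitz_boundary Omega ->
  0 < T -> 0 < alpha ->
  (exists C1 : R -> R,
    forall (umax uc M : R) (f : R -> 'rV[R]_l) (phi : R -> R)
      (u0 : 'rV[R]_l -> R) (m : mesh R l)
      (F : cell m -> cell m + bedge m -> R -> R -> R)
      (dt : R) (u : nat -> cell m -> R),
    problem_data umax uc f phi -> initial_datum Omega umax u0 ->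
    admissible_mesh Omega alpha m -> numerical_flux umax M f F ->
    0 < dt -> scheme_solution umax dt phi F u0 u ->
    forall eta : 'rV[R]_l,
    (\int[@lebesgue_measure R]_(t in `[0%R, T])
       xint (shifted Omega eta) (fun x =>
         (`|phi (approx_solution dt u t (x + eta))
            - phi (approx_solution dt u t x)| ^+ 2)%R%:E)
     <= (C1 (phi_seminorm T dt phi u) * enorm eta)%R%:E)%E)
  /\
  (forall (umax uc M : R) (f : R -> 'rV[R]_l) (phi : R -> R),
    problem_data umax uc f phi ->
    exists C2 : R,
    forall (u0 : 'rV[R]_l -> R) (m : mesh R l)
      (F : cell m -> cell m + bedge m -> R -> R -> R)
      (dt : R) (u : nat -> cell m -> R),
    initial_datum Omega umax u0 ->
    admissible_mesh Omega alpha m -> numerical_flux umax M f F ->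
    0 < dt -> scheme_solution umax dt phi F u0 u ->
    forall tau : R, 0 < tau < T ->
    (\int[@lebesgue_measure R]_(t in `[0%R, (T - tau)%R])
       xint Omega (fun x =>
         (`|phi (approx_solution dt u (t + tau) x)
            - phi (approx_solution dt u t x)| ^+ 2)%R%:E)
     <= (C2 * tau)%R%:E)%E).
Proof.
move=> l0 oO bO _ T0 al0; split.
  have [r r0 Or] := (bounded_cubeP Omega).1 bO.
  exists (fun s => 4 ^+ l / alpha * (2 * r + 2 * (l%:R * (r + r))) *
    (l%:R * 2) * l%:R * s ^+ 2).
  move=> umax uc M f phi u0 m F dt u pd _ am nf dt0 ss eta.
  exact: (@space_shift_le _ _ _ _ _ l0 oO bO al0 am
            _ _ _ _ _ _ pd dt0 r T eta r0 Or T0).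
move=> umax uc M f phi pd; have [k lk] := pd_phi_lip pd.
exists (`|k| * (20 * (vmeas Omega * (umax * phi umax)) +
  12 * T * ((`|M| * (umax + umax)) ^+ 2 *
    (2 * l%:R * alpha^-1 * alpha^-1 * vmeas Omega)))).
move=> u0 m F dt u _ am nf dt0 ss tau /andP[tau0 tauT].
apply: le_trans (time_shift_le oO bO am pd nf dt0 ss lk tau0 tauT) _.
rewrite lee_fin ler_wpM2r//; first exact: ltW.
rewrite ler_wpM2l// lerD2l ler_wpM2l//; first by rewrite mulr_ge0// ltW.
by rewrite ler_wpM2l ?sqr_ge0//; exact: (diamond_sum_le l0 oO bO al0 am).
Qed.
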